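(* Let $R>0$, and let $w$ be a real-valued (not necessarily non-negative) weight function on the disc $D_R\subset\mathbb{R}^2$ whose Fourier coefficients $w_{(k,\ell)}$ are each of constant sign on $[0,R]$ (pseudo-definiteness) and which satisfies $\|w\|:=\sum_{k=0}^{\infty}\sum_{\ell=1}^{a_k}\int_0^R|w_{(k,\ell)}(r)|\,r\,dr<\infty$. Let $N\ge 1$, $K\ge 0$, $M\ge 1$ be integers with $M$ odd, let $N_1\ge 5$ be an integer, let $0=R_0<R_1<\dots<R_{N_1}=R$, and put $h=\max_{i}(R_{i+1}-R_i)$. Let $f\in C^\infty(\overline{D_R})$. Then the difference between the Hybrid Polyharmonic Cubature $I^{\mathrm{spline}}_{(N,M,K,N_1)}(f)$ and the Discrete Polyharmonic Cubature $I^{\mathrm{poly}}_{(N,M,K)}(f)$ satisfies $$\left|I^{\mathrm{spline}}_{(N,M,K,N_1)}(f)-I^{\mathrm{poly}}_{(N,M,K)}(f)\right|\le \sqrt{\pi}\,C\,h^4\left\|\frac{\partial^4 f(re^{i\varphi})}{\partial r^4}\right\|_{L_\infty(\overline{D_R})}\sum_{k=0}^{K}\sum_{\ell=1}^{a_k}\int_0^R|w_{(k,\ell)}(r)|\,r\,dr$$ $$\le \sqrt{\pi}\,C\,h^4\left\|\frac{\partial^4 f(re^{i\varphi})}{\partial r^4}\right\|_{L_\infty(\overline{D_R})}\|w\|.$$ Here $C>0$ is the constant $C_0$ in the error bound for not-a-knot cubic spline interpolation recalled in the context; it is independent of $f$ and $h$.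
   Context: Disc and harmonics. $D_R$ is the disc of radius $R$ centred at $0$ in $\mathbb{R}^2$; points are written $re^{i\varphi}=(r\cos\varphi,r\sin\varphi)$. Put $a_0=1$, $a_k=2$ for $k\ge1$, and $Y_{(0,1)}(\varphi)=\frac{1}{\sqrt{2\pi}}$, $Y_{(k,1)}(\varphi)=\frac{1}{\sqrt{\pi}}\cos k\varphi$, $Y_{(k,2)}(\varphi)=\frac{1}{\sqrt{\pi}}\sin k\varphi$ for $k\ge1$. The Fourier coefficients of $w$ are $w_{(k,\ell)}(r)=\int_0^{2\pi}w(re^{i\varphi})Y_{(k,\ell)}(\varphi)\,d\varphi$. Pseudo-definiteness means: for each $(k,\ell)$, either $w_{(k,\ell)}\ge0$ on $[0,R]$ or $w_{(k,\ell)}\le0$ on $[0,R]$. Gauss quadrature. For each $(k,\ell)$, let $t_{1,(k,\ell)}<\dots<t_{N,(k,\ell)}$ in $(0,R^2)$ and $\lambda_{1,(k,\ell)},\dots,\lambda_{N,(k,\ell)}$ be the nodes and weights of the $N$-point Gauss (Gauss–Jacobi) quadrature on $[0,R^2]$ for the measure $\frac12\rho^{k/2}w_{(k,\ell)}(\sqrt\rho)\,d\rho$, i.e. for all integers $0\le s\le 2N-1$ $$\sum_{j=1}^N\lambda_{j,(k,\ell)}\,t_{j,(k,\ell)}^s=\frac12\int_0^{R^2}\rho^s\rho^{k/2}w_{(k,\ell)}(\sqrt\rho)\,d\rho .$$ The weights $\lambda_{j,(k,\ell)}$, $j=1,\dots,N$, are all of the same sign. (If $w_{(k,\ell)}=0$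 almost everywhere, all $\lambda_{j,(k,\ell)}$ are $0$ and the corresponding terms in the cubatures are $0$.) Discrete Fourier transform. For $0<r\le R$, $$f^{(M)}_{(k,\ell)}(r)=\frac{2\pi}{M}\sum_{s=1}^M f\left(re^{i\frac{2\pi s}{M}}\right)Y_{(k,\ell)}\left(\tfrac{2\pi s}{M}\right).$$ At the knot $R_0=0$ the values used as spline data are prescribed separately (because the exact Fourier coefficients of $f\in C^\infty(\overline{D_R})$ satisfy $f_{(k,\ell)}(0)=0$ for $k\ge1$): one puts $$f^{(M)}_{(k,\ell)}(0)=0\quad\text{for }k\ge1,\qquad f^{(M)}_{(0,1)}(0)=\sqrt{2\pi}\,f(0).$$ Discrete Polyharmonic Cubature: $$I^{\mathrm{poly}}_{(N,M,K)}(f)=\frac12\sum_{k=0}^K\sum_{\ell=1}^{a_k}\sum_{j=1}^N\lambda_{j,(k,\ell)}\,t_{j,(k,\ell)}^{-k/2}\,f^{(M)}_{(k,\ell)}\left(\sqrt{t_{j,(k,\ell)}}\right).$$ Not-a-knot spline. For data $V=(V_0,\dots,V_{N_1})\in\mathbb{C}^{N_1+1}$, $SPL[V]$ denotes the $C^2$ piecewise cubic function on $[0,R]$ with knots $R_0<\dots<R_{N_1}$ such that $SPL[V](R_j)=V_j$ for $j=0,\dots,N_1$ and whose third derivative is continuous at $R_1$ and at $R_{N_1-1}$ (the not-a-knot conditions). Hybrid Polyharmonic Cubature: $$I^{\mathrm{spline}}_{(N,M,K,N_1)}(f)=\frac12\sum_{k=0}^K\sum_{\ell=1}^{a_k}\sum_{j=1}^N\lambda_{j,(k,\ell)}\,t_{j,(k,\ell)}^{-k/2}\;SPL\left[\{f^{(M)}_{(k,\ell)}(R_m)\}_{m=0}^{N_1}\right]\left(\sqrt{t_{j,(k,\ell)}}\right),$$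 where the datum for $m=0$ is the prescribed value $f^{(M)}_{(k,\ell)}(0)$ above. The constant $C=C_0$. It is taken from the following known result (de Boor; Beatson): for $N_1\ge5$, knots $a=R_0<\dots<R_{N_1}=b$ with $h=\max_i(R_{i+1}-R_i)$ and $g\in C^4([a,b])$, the not-a-knot cubic spline $s$ interpolating $g$ at these knots satisfies $\|g-s\|_{\infty}\le C_0\,\|g^{(4)}\|_{L_\infty[a,b]}\,h^4$, where $C_0$ is independent of $g$ and of the grid size $h$.
   Formalization: Added hypothesis: f(0)=0 whenever K≥M. Otherwise, for k divisible by M, the prescribed value 0 at the knot 0 disagrees with the discrete Fourier transform, and the bound fails (e.g. f=1, M=K=N=1, only w_(1,1)=r nonzero). *)

(* Defs.v *)
From HB Require Import structures.
From mathcomp Require Import all_boot all_order all_algebra.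
From mathcomp Require Import all_classical all_reals all_analysis.
From mathcomp Require Import complex.

Set Implicit Arguments.
Unset Strict Implicit.
Unset Printing Implicit Defensive.

Import Order.TTheory GRing.Theory Num.Theory.
Import numFieldNormedType.Exports.

Local Open Scope classical_set_scope.
Local Open Scope complex_scope.
Local Open Scope ring_scope.

Section FunctionSpaces.
Context {R : realType}.

(** For open [U], all derivatives of [f] of order at most [n] exist on [U] and
    extend continuously to [closure U].  Only the values of [f] on [U] matter. *)
Fixpoint Cn_upto (V : normedModType R) (U : set V) (n : nat) (f : V -> R)
    : Prop :=
  (exists F : V -> R,
     {within closure U, continuous F} /\ (forall x, U x -> f x = F x)) /\
  match n with
  | 0%N => True
  | m.+1 => (forall x, U x -> differentiable f x) /\
            (forall v, Cn_upto U m ('D_v f))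
  end.

(** The class $C^n(\overline U)$. *)
Definition Cn_closure (V : normedModType R) (U : set V) (n : nat)
    (f : V -> R) : Prop :=
  {within closure U, continuous f} /\ Cn_upto U n f.

Definition Linfty d (T : measurableType d) (mu : {measure set T -> \bar R})
    (D : set T) (u : T -> R) : \bar R :=
  ('N[mu]_+oo [(EFin \o u) \_ D])%E.

End FunctionSpaces.

Section Disc.
Context {R : realType}.

Definition disc (Rad : R) : set (R * R) :=
  [set p | p.1 ^+ 2 + p.2 ^+ 2 < Rad ^+ 2].

Definition closed_disc (Rad : R) : set (R * R) :=
  [set p | p.1 ^+ 2 + p.2 ^+ 2 <= Rad ^+ 2].

Definition polar (r phi : R) : R * R := (r * cos phi, r * sin phi).

Definition Cinfty_closed_disc (Rad : R) (f : R * R -> R[i]) : Prop :=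
  forall n : nat,
    Cn_closure (disc Rad) n (fun p => complex.Re (f p)) /\
    Cn_closure (disc Rad) n (fun p => complex.Im (f p)).

(** $\partial^n f(re^{i\varphi})/\partial r^n$ at the point
    $p = re^{i\varphi} \ne 0$.  The value at the origin, where the radial
    direction is undefined, is irrelevant for the $L_\infty$ norm below. *)
Definition radial_derive (n : nat) (f : R * R -> R[i]) (p : R * R) : R[i] :=
  let r := Num.sqrt (p.1 ^+ 2 + p.2 ^+ 2) in
  let ray (s : R) := f (s * (p.1 / r), s * (p.2 / r)) in
  derive1n n (fun s => complex.Re (ray s)) r +i* derive1n n (fun s => complex.Im (ray s)) r.

Definition Linfty_closed_disc (Rad : R) (u : R * R -> R[i]) : \bar R :=
  Linfty (lebesgue_measure \x lebesgue_measure)%E (closed_disc Rad)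
    (fun p => Normc.normc (u p)).

Definition a_ (k : nat) : nat := if k == 0%N then 1%N else 2%N.

(** The index [l] ranges over [1 <= l <= a_ k]. *)
Definition Y (k l : nat) (phi : R) : R :=
  if k == 0%N then (Num.sqrt (2 * pi))^-1
  else if l == 1%N then (Num.sqrt pi)^-1 * cos (k%:R * phi)
  else (Num.sqrt pi)^-1 * sin (k%:R * phi).

Definition fourier (w : R * R -> R) (k l : nat) (r : R) : R :=
  \int[lebesgue_measure]_(phi in `[0, 2 * pi]) (w (polar r phi) * Y k l phi).

Definition pseudo_definite (Rad : R) (w : R * R -> R) : Prop :=
  forall k l : nat, (1 <= l <= a_ k)%N ->
    (forall r, 0 <= r <= Rad -> 0 <= fourier w k l r) \/
    (forall r, 0 <= r <= Rad -> fourier w k l r <= 0).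

(** The Fourier coefficients of [w], and the integrals of
    $|w_{(k,\ell)}(r)|\,r$ over $[0,R]$, are meaningful. *)
Definition has_fourier (Rad : R) (w : R * R -> R) : Prop :=
  (forall r, 0 <= r <= Rad ->
     lebesgue_measure.-integrable `[0, 2 * pi]
       (fun phi => (w (polar r phi))%:E)) /\
  (forall k l : nat, (1 <= l <= a_ k)%N ->
     measurable_fun `[0, Rad] (fourier w k l)).

Definition weight_term (Rad : R) (w : R * R -> R) (k : nat) : \bar R :=
  (\sum_(1 <= l < (a_ k).+1)
     \int[lebesgue_measure]_(r in `[0%R, Rad]) (`|fourier w k l r| * r)%:E)%E.

Definition weight_norm (Rad : R) (w : R * R -> R) : \bar R :=
  (\sum_(0 <= k <oo) weight_term Rad w k)%E.

(** Nodes and weights are indexed by [j < N]. *)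
Definition gauss_quadrature (Rad : R) (w : R * R -> R) (N k l : nat)
    (t lambda : nat -> R) : Prop :=
  [/\ forall i j : nat, (i < j < N)%N -> t i < t j,
      forall j : nat, (j < N)%N -> 0 < t j < Rad ^+ 2 &
      forall s : nat, (s <= 2 * N - 1)%N ->
        \sum_(j < N) lambda j * t j ^+ s =
        2^-1 * \int[lebesgue_measure]_(x in `[0, Rad ^+ 2])
                 (x ^+ s * x `^ (k%:R / 2) * fourier w k l (Num.sqrt x))].

Definition dft (M : nat) (f : R * R -> R[i]) (k l : nat) (r : R) : R[i] :=
  (2 * pi / M%:R)%:C *
  \sum_(1 <= s < M.+1)
    f (polar r (2 * pi * s%:R / M%:R)) * (Y k l (2 * pi * s%:R / M%:R))%:C.

(** At the knot 0 the datum is prescribed and is not the value of [dft]. *)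
Definition spline_data (M : nat) (f : R * R -> R[i]) (knot : nat -> R)
    (k l m : nat) : R[i] :=
  if m == 0%N then
    if k == 0%N then (Num.sqrt (2 * pi))%:C * f (0, 0) else 0
  else dft M f k l (knot m).

Definition cubature (N K : nat) (t lambda : nat -> nat -> nat -> R)
    (F : nat -> nat -> R -> R[i]) : R[i] :=
  2^-1 * \sum_(0 <= k < K.+1) \sum_(1 <= l < (a_ k).+1) \sum_(j < N)
    (lambda k l j * t k l j `^ (- (k%:R / 2)))%:C * F k l (Num.sqrt (t k l j)).

Definition I_poly (N M K : nat) (t lambda : nat -> nat -> nat -> R)
    (f : R * R -> R[i]) : R[i] :=
  cubature N K t lambda (dft M f).

Definition I_spline (N M K : nat) (t lambda : nat -> nat -> nat -> R)
    (knot : nat -> R) (SPL : (nat -> R[i]) -> R -> R[i])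
    (f : R * R -> R[i]) : R[i] :=
  cubature N K t lambda (fun k l => SPL (spline_data M f knot k l)).

End Disc.

Section Splines.
Context {R : realType}.

Definition grid (a b : R) (N1 : nat) (knot : nat -> R) : Prop :=
  [/\ knot 0%N = a, knot N1 = b &
      forall i : nat, (i < N1)%N -> knot i < knot i.+1].

Definition mesh (N1 : nat) (knot : nat -> R) : R :=
  \big[Num.max/0]_(i < N1) (knot i.+1 - knot i).

Definition third_derivative_continuous_at (s : R -> R) (x : R) : Prop :=
  derivable (derive1n 2 s) x 1 /\ {for x, continuous (derive1n 3 s)}.

Definition not_a_knot_spline (N1 : nat) (knot V : nat -> R) (s : R -> R)
    : Prop :=
  [/\ Cn_closure (`]knot 0%N, knot N1[ : set R) 2 s,
      forall j : nat, (j < N1)%N ->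
        exists p : {poly R}, (size p <= 4)%N /\
          forall x, knot j <= x <= knot j.+1 -> s x = p.[x],
      forall j : nat, (j <= N1)%N -> s (knot j) = V j,
      third_derivative_continuous_at s (knot 1%N) &
      third_derivative_continuous_at s (knot N1.-1)].

(** Real and imaginary parts of a complex spline are real splines. *)
Definition not_a_knot_splineC (N1 : nat) (knot : nat -> R) (V : nat -> R[i])
    (s : R -> R[i]) : Prop :=
  not_a_knot_spline N1 knot (fun j => complex.Re (V j)) (fun x => complex.Re (s x)) /\
  not_a_knot_spline N1 knot (fun j => complex.Im (V j)) (fun x => complex.Im (s x)).

(** [C] is an admissible constant in the error estimate of de Boor and Beatson
    on [[a, b]], uniformly in the number of knots, the grid and [g]. *)
Definition not_a_knot_constant (a b C : R) : Prop :=
  0 < C /\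
  forall (N1 : nat) (knot : nat -> R) (g s : R -> R),
    (5 <= N1)%N -> grid a b N1 knot ->
    Cn_closure (`]a, b[ : set R) 4 g ->
    not_a_knot_spline N1 knot (fun j => g (knot j)) s ->
    forall x, a <= x <= b ->
      ((`|g x - s x|)%:E <=
       C%:E * Linfty lebesgue_measure `[a, b] (derive1n 4 g)
         * (mesh N1 knot ^+ 4)%:E)%E.

End Splines.

(* Main.v *)
(** Both cubatures are sums of [lambda t^(-k/2)] against values at the Gauss
    nodes, so their difference is a sum of spline errors weighted by
    [lambda t^(-k/2)].

    Spline errors.  At the knot 0 the prescribed datum equals the value of the
    discrete Fourier transform (for [0 < k < M] because the harmonics sum to 0
    over the [M]-th roots of unity, for [k >= M] because [f(0) = 0]), hence the
    spline interpolates [g(r) = f^(M)_(k,l)(r)], a combination of restrictions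
    of [f] to rays.  The real error bound is applied to the real part of [c (g - s)], where the
    unimodular [c] makes the error at the given point a nonnegative real; this
    loses no constant.  The essential supremum of the fourth derivative of [g]
    is bounded by [2 sqrt pi] times that of the radial derivative of [f] on the
    disc, since the latter is continuous away from the origin, so each of its
    values is at most its essential supremum.

    Weights.  The sum of [|lambda| t^(-k/2)] is at most the integral of
    [|w_(k,l)(r)| r].  Indeed [rho^(-k/2)] lies in the cone generated by the
    products of functions [1 / (sqrt rho + s)] with [s >= 0], which is stable
    under divided differences up to sign; hence it is a polynomial of degree
    [2N - 1] plus [prod_j (rho - t_j)^2] times an element of the cone, and
    Gauss quadrature underestimates its integral. *)

From HB Require Import structures.
Require Import Defs.
From mathcomp Require Import all_boot all_order all_algebra.
From mathcomp Require Import all_classical all_reals all_analysis.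
From mathcomp Require Import complex.
From mathcomp Require Import measurable_realfun ess_sup_inf ring lra zify.
Import Order.TTheory GRing.Theory Num.Theory.
Import numFieldNormedType.Exports.
Set Implicit Arguments.
Unset Strict Implicit.
Unset Printing Implicit Defensive.
Local Open Scope classical_set_scope.
Local Open Scope ring_scope.

(** * Gauss quadrature of functions of the square root *)

(** An inductive predicate, so that sign and divided differences are handled by induction on how the
    function is built. Repeated division with [s = 0] yields the powers [x^(-k/2)]. *)
Inductive sqrt_cone (R : realType) : (R -> R) -> Prop :=
| sqrt_cone_cst c : 0 <= c -> sqrt_cone (fun=> c)
| sqrt_coneD u v : sqrt_cone u -> sqrt_cone v ->
    sqrt_cone (fun x => u x + v x)
| sqrt_cone_div u s : 0 <= s -> sqrt_cone u ->
    sqrt_cone (fun x => u x / (Num.sqrt x + s)).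

Lemma sqrt_cone_ge0 (R : realType) (u : R -> R) x : sqrt_cone u -> 0 <= u x.
Proof.
elim=> [c //|v w _ v0 _ w0|v s s0 _ v0]; first exact: addr_ge0.
by rewrite divr_ge0// addr_ge0// sqrtr_ge0.
Qed.

(* The divided difference of [1 / (sqrt x + s)] at [x] and [t] is
   [- 1 / ((sqrt x + s) (sqrt t + s) (sqrt x + sqrt t))]: up to sign, the cone
   is stable under divided differences. *)
Lemma sqrt_cone_divdiff (R : realType) (u : R -> R) t : 0 < t -> sqrt_cone u ->
  exists2 v, sqrt_cone v & forall x, 0 < x -> u x = u t - (x - t) * v x.
Proof.
move=> t0; elim=> [c c0|v w _ [v' cv' vE] _ [w' cw' wE]|v s s0 cv [v' cv' vE]].
- by exists (fun=> 0) => [|x x0]; [exact: sqrt_cone_cst|rewrite mulr0 subr0].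
- exists (fun x => v' x + w' x) => [|x x0]; first exact: sqrt_coneD.
  by rewrite vE// wE//; ring.
(* Leibniz rule for divided differences: the first summand differences [v], the second differences
   [1 / (sqrt x + s)] with [v] frozen at [t]. There [v t / (sqrt t + s)] is a nonnegative constant,
   and [1 / (sqrt x + sqrt t)] is a generator with shift [sqrt t]. *)
- exists (fun x => v' x / (Num.sqrt x + s) +
    v t / (Num.sqrt t + s) / (Num.sqrt x + s) / (Num.sqrt x + Num.sqrt t)).
    apply: sqrt_coneD; first exact: sqrt_cone_div.
    apply: sqrt_cone_div; first exact: sqrtr_ge0.
    apply: sqrt_cone_div => //.
    apply: sqrt_cone_cst; apply: divr_ge0; first exact: sqrt_cone_ge0.
    by rewrite addr_ge0// sqrtr_ge0.
  move=> x x0; rewrite vE//.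
  have sx : 0 < Num.sqrt x by rewrite sqrtr_gt0.
  have st : 0 < Num.sqrt t by rewrite sqrtr_gt0.
  have -> : x - t = (Num.sqrt x - Num.sqrt t) * (Num.sqrt x + Num.sqrt t).
    by rewrite -subr_sqr !sqr_sqrtr// ltW.
  have n1 : Num.sqrt x + s != 0 by rewrite gt_eqF// ltr_wpDr.
  have n2 : Num.sqrt t + s != 0 by rewrite gt_eqF// ltr_wpDr.
  have n3 : Num.sqrt x + Num.sqrt t != 0 by rewrite gt_eqF// addr_gt0.
  by field; rewrite n1 n2 n3.
Qed.

(** Hermite interpolation at double nodes, in Newton form: each new node serves for two successive
    divided differences of the remainder, and the two sign changes cancel. *)
Lemma sqrt_cone_hermite (R : realType) (u : R -> R) (N : nat) (t : nat -> R) :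
  (forall j, (j < N)%N -> 0 < t j) -> sqrt_cone u ->
  exists p : {poly R}, exists v, [/\ (size p <= 2 * N)%N, sqrt_cone v &
    forall x, 0 < x -> u x = p.[x] + (\prod_(j < N) (x - t j) ^+ 2) * v x].
Proof.
move=> + cu; elim: N => [_|N IH t0].
  exists 0, u; split; rewrite ?size_poly0// => x _.
  by rewrite big_ord0 horner0 add0r mul1r.
have [|p [v [sp cv uE]]] := IH.
  by move=> j jN; apply: t0; rewrite ltnS ltnW.
have tN := t0 _ (ltnSn N).
have [v1 cv1 v1E] := sqrt_cone_divdiff tN cv.
have [v2 cv2 v2E] := sqrt_cone_divdiff tN cv1.
exists (p + (\prod_(j < N) ('X - (t j)%:P) ^+ 2) *
   ((v (t N))%:P - v1 (t N) *: ('X - (t N)%:P))), v2.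
split=> // [|x x0]; last first.
  rewrite big_ord_recr/= hornerD hornerM hornerD hornerN hornerZ hornerXsubC.
  rewrite hornerC horner_prod.
  under [in RHS]eq_bigr do rewrite horner_exp hornerXsubC.
  by rewrite uE// v1E// v2E//; ring.
have sQ : size (\prod_(j < N) ('X - (t j)%:P) ^+ 2) = (2 * N).+1.
  elim: {+}N => [|n IHn]; first by rewrite big_ord0 size_poly1.
  rewrite big_ord_recr/= size_mul; last 2 first.
  - by rewrite -size_poly_gt0 IHn.
  - by rewrite expf_neq0// polyXsubC_eq0.
  by rewrite IHn size_exp_XsubC; lia.
rewrite (leq_trans (size_polyD _ _))// geq_max; apply/andP; split.
  by rewrite (leq_trans sp)// leq_mul2l/=.
rewrite (leq_trans (size_polyMleq _ _))// sQ.
have : (size ((v (t N))%:P - v1 (t N) *: ('X - (t N)%:P) : {poly R})%R <= 2)%N.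
  rewrite (leq_trans (size_polyD _ _))// geq_max size_polyN.
  rewrite (leq_trans (size_polyC_leq1 _))//=.
  by rewrite (leq_trans (size_scale_leq _ _))// size_XsubC.
lia.
Qed.

Section GaussQuadrature.
Context {R : realType}.
Variables (b : R) (omega : R -> R) (N : nat) (t lambda : nat -> R).
Local Notation mu := (@lebesgue_measure R).
Local Notation D := (`]0, b]%classic : set R).

Hypothesis omega_ge0 : forall x, D x -> 0 <= omega x.
Hypothesis omega_int : mu.-integrable D (EFin \o omega).
Hypothesis t_lt : forall i j : nat, (i < j < N)%N -> t i < t j.
Hypothesis t_gt0 : forall j : nat, (j < N)%N -> 0 < t j.
Hypothesis exact_monomial : forall s : nat, (s < 2 * N)%N ->
  \sum_(j < N) lambda j * t j ^+ s = \int[mu]_(x in D) (x ^+ s * omega x).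

Lemma integrable_continuous_mul (g : R -> R) : continuous g ->
  mu.-integrable D (EFin \o (fun x => g x * omega x)).
Proof.
move=> cg.
rewrite (_ : EFin \o _ = (EFin \o g) \* (EFin \o omega))%E; last first.
  by apply/funext => x /=; rewrite EFinM.
apply: integrableMr => //.
  by apply: measurable_funTS; exact: continuous_measurable_fun.
have : compact (g @` `[0, b]).
  apply: continuous_compact; last exact: segment_compact.
  by apply: continuous_subspaceT => x; exact: cg.
move=> /compact_bounded [M [Mr MM]].
exists M; split => // x Mx y /= Dy; apply: (MM x Mx).
by exists y => //; move: Dy; rewrite /= !in_itv/= => /andP[/ltW -> ->].
Qed.

Lemma gauss_exact_poly (p : {poly R}) : (size p <= 2 * N)%N ->
  \sum_(j < N) lambda j * p.[t j] = \int[mu]_(x in D) (p.[x] * omega x).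
Proof.
move=> sp.
have intX s : mu.-integrable D (EFin \o (fun x => p`_s * (x ^+ s * omega x))).
  rewrite (_ : (fun x => _) = (fun x => (p`_s * x ^+ s) * omega x)); last first.
    by apply/funext => x; rewrite mulrA.
  apply: integrable_continuous_mul => x.
  by apply: cvgM; [exact: cvg_cst|exact: exprn_continuous].
(* Integrability is carried along the induction because additivity of the integral requires it. *)
have eqn n : (n <= 2 * N)%N ->
    mu.-integrable D (EFin \o (fun x => \sum_(i < n) p`_i * (x ^+ i * omega x)))
    /\ \int[mu]_(x in D) (\sum_(i < n) p`_i * (x ^+ i * omega x)) =
    \sum_(i < n) p`_i * \sum_(j < N) lambda j * t j ^+ i.
  elim: n => [_|n IHn nN].
    rewrite (_ : (fun x => _) = cst 0); last by apply/funext => x; rewrite big_ord0.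
    by rewrite big_ord0 Rintegral_cst// mul0r; split => //; exact: integrable0.
  have [iI iE] := IHn (ltnW nN).
  rewrite (_ : (fun x => _) = (fun x => \sum_(i < n) p`_i * (x ^+ i * omega x) +
    p`_n * (x ^+ n * omega x))); last by apply/funext => x; rewrite big_ord_recr.
  split.
    exact: (integrableD _ iI (intX n)).
  rewrite RintegralD// iE big_ord_recr/=; congr (_ + _).
  rewrite exact_monomial// RintegralZl//.
  by apply: integrable_continuous_mul; exact: exprn_continuous.
have [_ E] := eqn _ sp.
transitivity (\sum_(i < size p) p`_i * \sum_(j < N) lambda j * t j ^+ i).
  under [RHS]eq_bigr do rewrite mulr_sumr.
  rewrite exchange_big/=; apply: eq_bigr => j _; rewrite horner_coef mulr_sumr.
  by apply: eq_bigr => i _; ring.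
rewrite -E; apply: eq_Rintegral => x _; rewrite horner_coef mulr_suml.
by apply: eq_bigr => i _; rewrite mulrA.
Qed.

(** The squared numerator of the [j]-th Lagrange polynomial has degree [2N - 2], so the rule is
    exact on it. It vanishes at every other node, and its integral against [omega] is
    nonnegative. *)
Lemma gauss_weight_ge0 j : (j < N)%N -> 0 <= lambda j.
Proof.
move=> jN; pose J := Ordinal jN.
pose L : {poly R} := \prod_(i < N | i != J) ('X - (t i)%:P) ^+ 2.
have LE x : L.[x] = \prod_(i < N | i != J) (x - t i) ^+ 2.
  by rewrite horner_prod; apply: eq_bigr => i _; rewrite horner_exp hornerXsubC.
have sL : (size L <= 2 * N)%N.
  rewrite /L.
  have := @size_prod_leq _ _ (fun i : 'I_N => i != J) (fun i => ('X - (t i)%:P) ^+ 2).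
  rewrite (eq_bigr (fun=> 3%N)) => [|i _]; last by rewrite size_exp_XsubC.
  rewrite sum_nat_const => /leq_trans; apply.
  have -> : #|(fun i : 'I_N => i != J)| = N.-1.
    by rewrite (cardC1 J) card_ord.
  lia.
have := gauss_exact_poly sL.
rewrite (bigD1 J)//= big1 ?addr0 => [|i iJ]; last first.
  by rewrite LE (bigD1 i)//= subrr expr0n mul0r mulr0.
have L0 : 0 < L.[t j].
  rewrite LE; apply: prodr_gt0 => i iJ; rewrite exprn_even_gt0//= subr_eq0.
  move: iJ; rewrite -val_eqE/= neq_ltn => /orP[ij|ji].
    by rewrite gt_eqF// t_lt// ij.
  by rewrite lt_eqF// t_lt// ji ltn_ord.
move=> E; rewrite -(pmulr_lge0 _ L0) E; apply: Rintegral_ge0 => x Dx.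
by rewrite mulr_ge0 ?omega_ge0// LE prodr_ge0// => i _; rewrite sqr_ge0.
Qed.

(** The Hermite remainder vanishes at every node, so the sum only sees the interpolating polynomial,
    which lies below [u] on [D]. Since [u] may blow up at 0, an integrable majorant [v] of [u omega]
    is used for the comparison. *)
Lemma gauss_le_integral (u v : R -> R) : sqrt_cone u ->
  mu.-integrable D (EFin \o v) ->
  (forall x, D x -> u x * omega x <= v x) ->
  \sum_(j < N) lambda j * u (t j) <= \int[mu]_(x in D) v x.
Proof.
move=> cu iv uv.
have [p [r [sp cr uE]]] := sqrt_cone_hermite t_gt0 cu.
have -> : \sum_(j < N) lambda j * u (t j) = \sum_(j < N) lambda j * p.[t j].
  apply: eq_bigr => j _; rewrite uE ?t_gt0//.
  by rewrite (bigD1 j)//= subrr expr0n !mul0r addr0.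
rewrite gauss_exact_poly//; apply: le_Rintegral => //.
  apply: integrable_continuous_mul; exact: continuous_horner.
move=> x Dx; apply: le_trans (uv _ Dx).
rewrite ler_wpM2r ?omega_ge0// uE; last by move: Dx; rewrite /= in_itv/= => /andP[].
by rewrite lerDl mulr_ge0 ?(sqrt_cone_ge0 _ cr)// prodr_ge0// => i _; rewrite sqr_ge0.
Qed.

End GaussQuadrature.

(** * The substitution [y = r ^ 2] *)

Section SquareSubstitution.
Context {R : realType}.
Local Notation mu := (@lebesgue_measure R).

(** The odd extension of [r^2]: an increasing bijection of the whole line with derivative [2|x|] and
    inverse [psi], which makes the substitution global. *)
Let phi (x : R) : R := x * `|x|.
Let psi (y : R) : R := Num.sg y * Num.sqrt `|y|.

Let phiK y : phi (psi y) = y.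
Proof.
rewrite /phi /psi normrM normr_sg (ger0_norm (sqrtr_ge0 _)).
have [->|y0] := eqVneq y 0; first by rewrite sgr0 !mul0r.
by rewrite mul1r -mulrA -expr2 sqr_sqrtr// -numEsg.
Qed.

Let phi_lt : {mono phi : x y / x < y}.
Proof.
apply: leW_mono; apply: le_mono => x y xy; rewrite /phi.
have [x0|x0] := leP 0 x; have [y0|y0] := leP 0 y.
- by rewrite !ger0_norm// -!expr2 ltr_pXn2r.
- by have := lt_trans xy y0; rewrite ltNge x0.
- rewrite (ltr0_norm x0) (ger0_norm y0); nra.
- rewrite !ltr0_norm//; nra.
Qed.

Let is_derive_phi x : is_derive (x : R) (1 : R) phi (2 * `|x|).
Proof.
have [x0|x0|->] := ltgtP x 0.
- apply: (@near_eq_is_derive R R R (fun y => - (y * y))) => //.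
  - near=> y; rewrite /phi ltr0_norm ?mulrN//.
    by near: y; exact: lt_nbhsl.
  - rewrite ltr0_norm//; apply: is_derive_eq.
    by rewrite /GRing.scale/=; ring.
- apply: (@near_eq_is_derive R R R (fun y => y * y)) => //.
  - near=> y; rewrite /phi gtr0_norm//.
    by near: y; exact: lt_nbhsr.
  - rewrite gtr0_norm//; apply: is_derive_eq.
    by rewrite /GRing.scale/=; ring.
(* At 0 neither [x^2] nor [-x^2] describes [phi] on a full neighbourhood; the difference quotient
   there is [|h|]. *)
- have L : h^-1 *: ((phi \o shift 0) (h *: 1) - phi 0) @[h --> 0^'] --> (0 : R).
    apply: (@cvg_trans _ (`|h| @[h --> (0:R)^'])).
      apply: near_eq_cvg; near=> h; rewrite /phi /shift/= mul0r subr0 addr0.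
      rewrite /GRing.scale/= mulr1 mulrA mulVf ?mul1r//.
      by near: h; exact: nbhs_dnbhs_neq.
    suff : `|h| @[h --> (0 : R)^'] --> `|0 : R| by rewrite normr0.
    by apply: cvg_norm; apply: cvg_within_filter; exact: cvg_id.
  rewrite normr0 mulr0; split; first by apply/cvg_ex; exists 0; exact: L.
  exact/cvg_lim.
Unshelve. all: by end_near. Qed.

(** The image under [phi] of the measure with density [phi' = 2|x|]. Identifying it with Lebesgue
    measure is the substitution formula for indicators. *)
Definition sq_measure : set (measurableTypeR R) -> \bar R := fun A =>
  (\int[mu]_(x in phi @^-1` A) (2 * `|x|)%:E)%E.

Let dens_ge0 (x : R) : (0 <= (2 * `|x|)%:E :> \bar R)%E.
Proof. by rewrite lee_fin mulr_ge0. Qed.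

Let measurable_dens : measurable_fun setT (fun x : R => (2 * `|x|)%:E).
Proof.
by apply/measurable_EFinP; apply: measurable_funM => //; exact: measurableT_comp.
Qed.

Let measurable_phi : measurable_fun setT phi.
Proof. by apply: measurable_funM => //; exact: measurableT_comp. Qed.

Let measurable_preimage A : measurable A -> measurable (phi @^-1` A).
Proof. by move=> mA; rewrite -[X in measurable X]setTI; exact: measurable_phi. Qed.

Let sq_measure0 : sq_measure set0 = 0%E.
Proof. by rewrite /sq_measure preimage_set0 integral_set0. Qed.

Let sq_measure_ge0 A : (0 <= sq_measure A)%E.
Proof. exact: integral_ge0. Qed.

Let sq_measure_sigma_additive : semi_sigma_additive sq_measure.
Proof.
move=> /= F mF tF mUF; rewrite /sq_measure; apply: cvg_toP.
  apply: ereal_nondecreasing_is_cvgn => m n mn.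
  by apply: lee_sum_nneg_natr => // k _ _; exact: integral_ge0.
rewrite preimage_bigcup ge0_integral_bigcup//=.
- move=> i; exact: (measurable_preimage (mF i)).
- exact: measurable_funTS.
- apply/trivIsetP => i j _ _ ij; rewrite -preimage_setI.
  by move/trivIsetP : tF => /(_ i j Logic.I Logic.I ij) ->; rewrite preimage_set0.
Qed.

HB.instance Definition _ := isMeasure.Build _ (measurableTypeR R) R sq_measure
  sq_measure0 sq_measure_ge0 sq_measure_sigma_additive.

Let continuous_phi : continuous phi.
Proof.
move=> x; apply: differentiable_continuous; apply/derivable1_diffP.
exact: ex_derive.
Qed.

(** By uniqueness of Lebesgue measure it suffices to test []a, b]]. Its preimage is []psi a, psi
    b]], over which the fundamental theorem of calculus gives [b - a]. *)
Let sq_measureE A : measurable A -> mu A = sq_measure A.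
Proof.
move=> mA; apply: (@lebesgue_measure_unique R sq_measure _ A mA) => _ [[a b]] _ <-/=.
rewrite lebesgue_measure_itv/= lte_fin /sq_measure.
have -> : phi @^-1` `]a, b] = `]psi a, psi b]%classic.
  apply/seteqP; split => x /=; rewrite !in_itv/= !leNgt;
  by rewrite -(phi_lt (psi a)) -(phi_lt (psi b)) !phiK.
have -> : (a < b) = (psi a < psi b) by rewrite -(phi_lt (psi a)) !phiK.
case: ltP => ab; last by rewrite set_itv_ge ?integral_set0// bnd_simp -leNgt.
rewrite integral_itv_obnd_cbnd; last exact: measurable_funTS.
rewrite (@continuous_FTC2 _ _ phi)// ?phiK//.
- apply: continuous_subspaceT => x; apply: cvgM; first exact: cvg_cst.
  by apply: cvg_norm; exact: cvg_id.
- split => [x _||]; first exact: ex_derive.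
  + by apply: cvg_at_right_filter; exact: continuous_phi.
  + by apply: cvg_at_left_filter; exact: continuous_phi.
- by move=> x _; rewrite derive1E; exact: derive_val.
Qed.

Import HBNNSimple.

Let integral_nnsfun (f : {nnsfun (measurableTypeR R) >-> R}) :
  (\int[mu]_x (f x)%:E = \int[mu]_x ((f (phi x))%:E * (2 * `|x|)%:E))%E.
Proof.
have mfr r : measurable (f @^-1` [set r]) by exact: measurable_sfunP.
have mfphi r : measurable_fun setT (fun x => (\1_(f @^-1` [set r]) (phi x))%:E : \bar R).
  apply/measurable_EFinP.
  exact: (@measurable_indic _ _ _ setT (phi @^-1` (f @^-1` [set r]))
           (measurable_preimage (mfr r))).
transitivity (\sum_(r \in range f) r%:E * sq_measure (f @^-1` [set r]))%E.
  under eq_integral do rewrite fimfunE -fsumEFin//.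
  rewrite ge0_integral_fsum//; last 2 first.
  - by move=> r; exact/measurable_EFinP/measurableT_comp.
  - by move=> n x _; rewrite EFinM nnfun_muleindic_ge0.
  apply: eq_fsbigr => r _.
  rewrite integralZl_indic_nnsfun// integral_indic// setIT.
  by congr (_ * _)%E; exact: sq_measureE.
symmetry.
under eq_integral.
  move=> x _; rewrite fimfunE -fsumEFin// ge0_mule_fsuml; last first.
    by move=> r; rewrite EFinM nnfun_muleindic_ge0.
  over.
rewrite ge0_integral_fsum//; last 2 first.
- move=> r; apply: emeasurable_funM => //.
  under eq_fun do rewrite EFinM.
  by apply: emeasurable_funM; [exact: measurable_cst|exact: mfphi].
- by move=> r x _; rewrite mule_ge0// EFinM nnfun_muleindic_ge0.
apply: eq_fsbigr => r _.
(* For [r < 0] the level set is empty; for [r >= 0] the constant can be pulled out of the integral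
   of a nonnegative function. *)
have [r0|r0] := ltP r 0.
  rewrite preimage_nnfun0// sq_measure0 mule0.
  by apply: integral0_eq => x _; rewrite indic0 mulr0 mul0e.
under eq_integral do rewrite EFinM -muleA.
rewrite ge0_integralZl//; last first.
  by apply: emeasurable_funM; [exact: mfphi|exact: measurable_dens].
congr (_ * _)%E; rewrite /sq_measure [RHS]integral_mkcond.
apply: eq_integral => x _; rewrite patchE indicE/=.
have -> : (phi x \in f @^-1` [set r]) = (x \in phi @^-1` (f @^-1` [set r])).
  by apply/idP/idP; rewrite !inE.
by case: ifPn => _; rewrite ?mul1e ?mul0e.
Qed.

(** Both sides are limits, by monotone convergence, along an increasing approximation of [v] by
    simple functions. *)
Lemma ge0_integral_mul_norm (v : R -> \bar R) :
  measurable_fun setT v -> (forall x, 0 <= v x)%E ->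
  (\int[mu]_x v x = \int[mu]_x (v (x * `|x|)%R * (2 * `|x|)%:E))%E.
Proof.
move=> mv' v0; have mv : measurable_fun [set: measurableTypeR R] v by exact: mv'.
pose f_ : {nnsfun (measurableTypeR R) >-> R}^nat := nnsfun_approx measurableT mv.
have cf x : (f_ n x)%:E @[n --> \oo] --> v x.
  exact: (@cvg_nnsfun_approx _ (measurableTypeR R) R setT measurableT v mv
    (fun x _ => v0 x) x Logic.I).
have nd (m n : nat) x : (m <= n)%N -> f_ m x <= f_ n x.
  by move=> mn; move: x; apply/lefP; exact: (nd_nnsfun_approx measurableT mv).
have mf n : measurable_fun [set: measurableTypeR R] (f_ n) by exact: measurable_funPT.
transitivity (limn (fun n => \int[mu]_x (f_ n x)%:E))%E.
  rewrite -monotone_convergence//.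
  - by apply: eq_integral => x _; apply/esym/cvg_lim => //; exact: cf.
  - by move=> n; apply/measurable_EFinP; exact: (mf n).
  - by move=> *; rewrite lee_fin.
  - by move=> x _ m n mn; rewrite lee_fin; exact: nd.
transitivity (limn (fun n => \int[mu]_x ((f_ n (phi x))%:E * (2 * `|x|)%:E)))%E.
  by congr (limn _); apply/funext => n; exact: (integral_nnsfun (f_ n)).
rewrite -monotone_convergence//.
- apply: eq_integral => x _; apply/cvg_lim => //.
  by apply: cvgeZr => //; exact: cf.
- move=> n; apply: emeasurable_funM => //; apply/measurable_EFinP.
  exact: (measurableT_comp (mf n) measurable_phi).
- by move=> n x _; rewrite mule_ge0// lee_fin.
- move=> x _ m n mn; rewrite lee_wpmul2r// lee_fin.
  exact: nd.
Qed.

(** The substitution is applied to [g (sqrt y)] extended by zero outside []0, b^2]]: the point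
    [x|x|] lies there exactly when [x] lies in []0, b]]. The endpoint 0 is a null set. *)
Lemma ge0_integral_comp_sqrt (b : R) (g : R -> R) : 0 <= b ->
  measurable_fun `[0, b] g -> (forall r, 0 <= r <= b -> 0 <= g r) ->
  (\int[mu]_(y in `]0%R, (b ^+ 2)%R]) (g (Num.sqrt y))%:E =
   2%:E * \int[mu]_(r in `[0%R, b]) (g r * r)%:E)%E.
Proof.
move=> b0 mg g0.
have sqrtI y : 0 < y <= b ^+ 2 -> 0 <= Num.sqrt y <= b.
  move=> /andP[y0 yb]; rewrite sqrtr_ge0/= -(ger0_norm b0) -sqrtr_sqr.
  by rewrite ler_wsqrtr.
have mgs : measurable_fun (`]0, b ^+ 2] : set R) (fun y => (g (Num.sqrt y))%:E).
  apply/measurable_EFinP.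
  apply: (@measurable_comp _ _ _ _ _ _ `[0, b]) => //.
    by move=> _ [y + <-]; rewrite /= !in_itv/=; exact: sqrtI.
  by apply: measurable_funTS; apply: continuous_measurable_fun; exact: sqrt_continuous.
rewrite integral_mkcond ge0_integral_mul_norm; last 2 first.
- exact/(measurable_restrictT _ _).1.
- move=> y; rewrite patchE; case: ifPn => //; rewrite inE/= in_itv/= => yb.
  by rewrite lee_fin g0// sqrtI.
rewrite -integral_itv_obnd_cbnd; last first.
  apply/measurable_EFinP; apply: measurable_funM => //.
  by apply: measurable_funS mg => //; apply: subset_itvr; rewrite bnd_simp.
rewrite -ge0_integralZl//; last 2 first.
- apply/measurable_EFinP; apply: measurable_funM => //.
  by apply: measurable_funS mg => //; apply: subset_itvr; rewrite bnd_simp.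
- move=> r /=; rewrite in_itv/= => /andP[r0 rb].
  by rewrite lee_fin mulr_ge0 ?g0 ?(ltW r0)// rb.
rewrite [RHS]integral_mkcond; apply: eq_integral => x _; rewrite !patchE.
have E : (x * `|x| \in `]0%R, b ^+ 2]%classic) = (x \in `]0%R, b]%classic).
  apply/idP/idP; rewrite !inE/= !in_itv/=.
    have [x0|x0] := leP x 0; first by rewrite ltNge mulr_le0_ge0.
    by rewrite gtr0_norm// -expr2 ler_pXn2r ?nnegrE ?(ltW x0)// => /andP[].
  move=> /andP[x0 xb]; rewrite gtr0_norm// mulr_gt0//= -expr2.
  by rewrite ler_pXn2r ?nnegrE ?(ltW x0).
rewrite E; case: ifPn => [|_]; last by rewrite mul0e.
rewrite inE/= in_itv/= => /andP[x0 xb].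
rewrite !gtr0_norm// -expr2 sqrtr_sqr gtr0_norm// -!EFinM.
by congr EFin; ring.
Qed.
End SquareSubstitution.

(** * Smooth functions along rays *)

Lemma iter_derive_eq (R : realType) (V : normedModType R) (U : set V) n
    (f g : V -> R) (u p : V) : open U -> U p ->
  (forall q, U q -> f q = g q) ->
  iter n (fun h => 'D_u h) f p = iter n (fun h => 'D_u h) g p.
Proof.
move=> oU Up fg; elim: n p Up => [|n IHn] p Up; first exact: fg.
by apply: near_eq_derive; near=> q; apply: IHn; near: q; exact: open_nbhs_nbhs.
Unshelve. all: by end_near. Qed.

Lemma iter_derive_lin (R : realType) (V : normedModType R) (U : set V) n
    (f g : V -> R) (a b : R) (u p : V) : open U -> U p ->
  Cn_upto U n f -> Cn_upto U n g ->
  iter n (fun h => 'D_u h) (fun q => a * f q + b * g q) p =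
  a * iter n (fun h => 'D_u h) f p + b * iter n (fun h => 'D_u h) g p.
Proof.
move=> oU Up; elim: n f g => // n IHn f g [_ [df cf]] [_ [dg cg]].
rewrite !iterSr -IHn; [|exact: cf|exact: cg].
apply: (iter_derive_eq _ _ oU Up) => q Uq.
have dfq : derivable f q u := diff_derivable (df _ Uq).
have dgq : derivable g q u := diff_derivable (dg _ Uq).
have := deriveD (derivableZ (k := a) dfq) (derivableZ (k := b) dgq).
by rewrite !deriveZ.
Qed.

Section RadialDerivatives.
Context {R : realType}.
Implicit Types (f g : R * R -> R) (U : set (R * R)).

Definition direction (phi : R) : R * R := (cos phi, sin phi).

(** The direction [v] on the line is arbitrary because [Cn_upto] quantifies over all directions. *)
Lemma derive_ray f (u : R * R) (v : R) :
  'D_v (fun r : R => f (r *: u)) = (fun r : R => 'D_(v *: u) f (r *: u)).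
Proof.
apply/funext => r; rewrite /derive.
rewrite (_ : (fun h => _) = (fun h => h^-1 *: (f (h *: (v *: u) + r *: u) - f (r *: u))))//.
by apply/funext => h /=; rewrite scalerDl -scalerA.
Qed.

Lemma derivable_ray f (u : R * R) (r v : R) :
  derivable f (r *: u) (v *: u) -> derivable (fun r : R => f (r *: u)) r v.
Proof.
rewrite /derivable => fu.
rewrite (_ : (fun h => _) = (fun h => h^-1 *: (f (h *: (v *: u) + r *: u) - f (r *: u))))//.
by apply/funext => h /=; rewrite scalerDl -scalerA.
Qed.

Lemma derive1n_ray n f (u : R * R) :
  derive1n n (fun r : R => f (r *: u)) =
  (fun r : R => iter n (fun g => 'D_u g) f (r *: u)).
Proof.
elim: n => // n IHn; rewrite derive1nS IHn; apply/funext => r.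
rewrite derive1E; have := congr1 (fun h => h r)
  (derive_ray (iter n (fun g => 'D_u g) f) u 1).
by rewrite scale1r; exact.
Qed.

Lemma continuous_polar (phi : R) : continuous (fun r : R => polar r phi).
Proof.
by move=> r; apply: (@scalel_continuous _ (R * R)%type (direction phi)).
Qed.

Lemma closure_ray (Rad phi r : R) : 0 < Rad ->
  closure (`]0, Rad[ : set R) r -> closure (disc Rad) (polar r phi).
Proof.
move=> R0 cr B /(@continuous_polar phi r) /cr [s [/= + Bs]].
rewrite in_itv/= => /andP[s0 sR]; exists (polar s phi); split => //=.
rewrite /disc/= !exprMn -mulrDr cos2Dsin2 mulr1.
by rewrite ltr_pXn2r// nnegrE ltW.
Qed.

Lemma disc_ray (Rad phi r : R) : 0 < r < Rad -> disc Rad (polar r phi).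
Proof.
move=> /andP[r0 rR]; rewrite /disc/= !exprMn -mulrDr cos2Dsin2 mulr1.
by rewrite ltr_pXn2r// nnegrE ltW// (lt_trans r0).
Qed.

Lemma within_continuous_ray (Rad phi : R) f : 0 < Rad ->
  {within closure (disc Rad), continuous f} ->
  {within closure (`]0, Rad[ : set R), continuous (fun r => f (polar r phi))}.
Proof.
move=> R0 /subspace_continuousP cf; apply/subspace_continuousP => r cr.
move=> B /(cf _ (closure_ray R0 cr)) fB.
have H : nbhs r (fun s => closure (disc Rad) (polar s phi) -> B (f (polar s phi))).
  exact: (continuous_polar fB).
change (nbhs r (fun s => closure (`]0, Rad[ : set R) s -> B (f (polar s phi)))).
by apply: filterS H => s /= H cs; apply: H; exact: closure_ray.
Qed.

Lemma Cn_upto_ray (Rad phi : R) n f : 0 < Rad -> Cn_upto (disc Rad) n f ->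
  Cn_upto (`]0, Rad[ : set R) n (fun r => f (polar r phi)).
Proof.
move=> R0; elim: n f => [|n IHn] f [[F [cF fF]] cn].
  split=> //; exists (fun r => F (polar r phi)); split.
    exact: within_continuous_ray.
  by move=> r /=; rewrite in_itv/= => rI; apply/fF/disc_ray.
case: cn => df cn; split; last split.
- exists (fun r => F (polar r phi)); split.
    exact: within_continuous_ray.
  by move=> r /=; rewrite in_itv/= => rI; apply/fF/disc_ray.
- move=> r /=; rewrite in_itv/= => rI; apply/derivable1_diffP.
  apply: (@derivable_ray f (direction phi)).
  exact/diff_derivable/df/disc_ray.
- move=> v; have -> : 'D_v (fun r => f (polar r phi)) =
      (fun r => 'D_(v *: direction phi) f (polar r phi)) := derive_ray f (direction phi) v.
  exact: (IHn _ (cn (v *: direction phi))).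
Qed.

Lemma Cn_closure_ray (Rad phi : R) n f : 0 < Rad ->
  Cn_closure (disc Rad) n f ->
  Cn_closure (`]0, Rad[ : set R) n (fun r => f (polar r phi)).
Proof.
by move=> R0 [cf cn]; split; [exact: within_continuous_ray|exact: Cn_upto_ray].
Qed.

(* [dirn n f u p] is the [n]-th derivative of [f] at [p] along [u], expanded
   in the partial derivatives of [f]: in this form it is visibly continuous
   in [(u, p)]. *)
Fixpoint dirn n f (u p : R * R) : R :=
  if n is m.+1 then u.1 * dirn m ('D_((1, 0) : R * R) f) u p
                    + u.2 * dirn m ('D_((0, 1) : R * R) f) u p
  else f p.

(** The differential is linear in the direction, so [D_u] splits along the canonical basis; this is
    iterated with [u] held fixed. *)
Lemma iter_deriveE U n f (u p : R * R) : open U -> U p -> Cn_upto U n f ->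
  iter n (fun h => 'D_u h) f p = dirn n f u p.
Proof.
move=> oU Up; elim: n f => // n IHn f [_ [df cf]].
rewrite iterSr/= -(IHn _ (cf (1, 0))) -(IHn _ (cf (0, 1))).
rewrite -(iter_derive_lin _ _ _ oU Up (cf (1, 0)) (cf (0, 1))).
apply: (iter_derive_eq _ _ oU Up) => q Uq.
rewrite !(deriveE _ (df _ Uq)).
have uE : u = u.1 *: ((1, 0) : R * R) + u.2 *: ((0, 1) : R * R).
  by case: (u) => u1 u2; congr (_, _); rewrite /= /GRing.scale/=; ring.
by rewrite [in LHS]uE linearD !linearZ.
Qed.

Lemma Cn_upto_continuous U n f p : open U -> U p -> Cn_upto U n f ->
  {for p, continuous f}.
Proof.
move=> oU Up cf; have [F [/subspace_continuousP cF fF]] :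
    exists F : R * R -> R,
      {within closure U, continuous F} /\ (forall x, U x -> f x = F x).
  by case: n cf => [|n] [].
have nU : nbhs p U by exact: open_nbhs_nbhs.
have cFp : F x @[x --> p] --> F p.
  move=> B /(cF _ (subset_closure Up)) FB.
  have H : nbhs p (fun q => closure U q -> B (F q)) by exact: FB.
  apply: filterS2 H nU => q FBq Uq; exact/FBq/subset_closure.
rewrite /prop_for /continuous_at (fF _ Up); apply: cvg_trans cFp.
by apply: near_eq_cvg; near=> q; rewrite fF//; near: q.
Unshelve. all: by end_near. Qed.

Lemma continuous_dirn U n f (T : topologicalType) (u q : T -> R * R) (x : T) :
  open U -> U (q x) -> Cn_upto U n f ->
  {for x, continuous u} -> {for x, continuous q} ->
  {for x, continuous (fun y => dirn n f (u y) (q y))}.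
Proof.
move=> oU Uq + cu cq; elim: n f => [|n IHn] f cf.
  by apply: continuous_comp => //; exact: Cn_upto_continuous cf.
case: cf => _ [_ cf]; apply: cvgD; apply: cvgM.
- by apply: (cvg_comp _ fst cu); exact: cvg_fst.
- exact: (IHn _ (cf (1, 0))).
- by apply: (cvg_comp _ snd cu); exact: cvg_snd.
- exact: (IHn _ (cf (0, 1))).
Qed.

Lemma continuous_sum_sqr : continuous (fun p : R * R => p.1 ^+ 2 + p.2 ^+ 2).
Proof.
move=> p; apply: cvgD.
- by apply: (@cvg_comp _ _ _ fst (fun x : R => x ^+ 2) _ (nbhs p.1));
    [exact: cvg_fst|exact: exprn_continuous].
- by apply: (@cvg_comp _ _ _ snd (fun x : R => x ^+ 2) _ (nbhs p.2));
    [exact: cvg_snd|exact: exprn_continuous].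
Qed.

Lemma open_disc (Rad : R) : open (disc Rad).
Proof.
have /continuousP c := continuous_sum_sqr.
suff -> : disc Rad = (fun p : R * R => p.1 ^+ 2 + p.2 ^+ 2) @^-1` [set x | x < Rad ^+ 2].
  by apply: c; exact: open_lt.
by [].
Qed.

Definition modulus (p : R * R) : R := Num.sqrt (p.1 ^+ 2 + p.2 ^+ 2).

Lemma continuous_modulus : continuous modulus.
Proof.
move=> p; apply: (@continuous_comp _ _ _ (fun p : R * R => p.1 ^+ 2 + p.2 ^+ 2)).
  exact: continuous_sum_sqr.
exact: sqrt_continuous.
Qed.

Lemma modulus_polar (r phi : R) : 0 <= r -> modulus (polar r phi) = r.
Proof.
move=> r0; rewrite /modulus/= !exprMn -mulrDr cos2Dsin2 mulr1 sqrtr_sqr.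
by rewrite ger0_norm.
Qed.

Lemma radial_derive_polar n (f : R * R -> R[i]) (r phi : R) : 0 < r ->
  radial_derive n f (polar r phi) =
  Complex (derive1n n (fun s => complex.Re (f (polar s phi))) r)
          (derive1n n (fun s => complex.Im (f (polar s phi))) r).
Proof.
move=> r0; rewrite /radial_derive -/(modulus _) modulus_polar ?ltW//=.
by rewrite -!mulrA ![r * (_ / r)]mulrCA !divff ?gt_eqF// !mulr1.
Qed.

(** Away from the origin the unit vector [p / |p|] depends continuously on [p], and the derivatives
    along it are given by [dirn], continuous in both arguments. *)
Lemma continuous_radial_derive (Rad phi : R) n (f : R * R -> R[i]) (r : R) :
  Cn_upto (disc Rad) n (fun p => complex.Re (f p)) ->
  Cn_upto (disc Rad) n (fun p => complex.Im (f p)) ->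
  0 < r < Rad ->
  {for polar r phi, continuous (fun p => Normc.normc (radial_derive n f p))}.
Proof.
move=> cRe cIm /[dup] rI /andP[r0 rR].
set p0 := polar r phi.
pose u (p : R * R) : R * R := (p.1 / modulus p, p.2 / modulus p).
have m0 : modulus p0 != 0 by rewrite modulus_polar ?gt_eqF// ltW.
have np0 : \forall p \near p0, modulus p != 0.
  have : nbhs (modulus p0) [set x | x != 0].
    by apply: open_nbhs_nbhs; split => //; exact: open_neq.
  by move=> /(@continuous_modulus p0).
have npd : \forall p \near p0, disc Rad p.
  by apply: open_nbhs_nbhs; split; [exact: open_disc|exact: disc_ray].
have cu : {for p0, continuous u}.
  have cv : (modulus p)^-1 @[p --> p0] --> (modulus p0)^-1.
    by apply: cvgV => //; exact: continuous_modulus.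
  apply: (@cvg_pair _ _ _ _ (nbhs (p0.1 / modulus p0)) (nbhs (p0.2 / modulus p0))).
  - by apply: cvgM cv; exact: cvg_fst.
  - by apply: cvgM cv; exact: cvg_snd.
pose G p := Num.sqrt (dirn n (fun p => complex.Re (f p)) (u p) p ^+ 2 +
                      dirn n (fun p => complex.Im (f p)) (u p) p ^+ 2).
have EG p : modulus p != 0 -> disc Rad p ->
    Normc.normc (radial_derive n f p) = G p.
  move=> mp dp; rewrite /radial_derive/= -/(modulus p) /G.
  have pE : p = modulus p *: u p.
    by case: (p) mp => p1 p2 mp; congr (_, _); rewrite /= /GRing.scale/= mulrC divfK.
  have E (h : R * R -> R) : Cn_upto (disc Rad) n h ->
      derive1n n (fun s => h (s * (p.1 / modulus p), s * (p.2 / modulus p))) (modulus p)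
      = dirn n h (u p) p.
    move=> ch; have := congr1 (fun h => h (modulus p)) (derive1n_ray n h (u p)).
    by rewrite -pE (iter_deriveE _ (@open_disc Rad) dp ch).
  by congr (Num.sqrt (_ ^+ 2 + _ ^+ 2)); [exact: E cRe|exact: E cIm].
have cG : {for p0, continuous G}.
  apply: (@continuous_comp _ _ _ _ (@Num.sqrt R)); last exact: sqrt_continuous.
  have dp0 : disc Rad p0 by exact: disc_ray.
  have cd h : Cn_upto (disc Rad) n h ->
      {for p0, continuous (fun p => dirn n h (u p) p ^+ 2)}.
    move=> ch; apply: (@continuous_comp _ _ _ _ (fun x : R => x ^+ 2)).
      by apply: (@continuous_dirn (disc Rad) n h _ u id) => //; exact: open_disc.
    exact: exprn_continuous.
  by apply: cvgD; exact: cd.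
rewrite /prop_for /continuous_at EG//; last exact: disc_ray.
apply: cvg_trans cG; apply: near_eq_cvg; near=> p; rewrite EG//; near: p => //.
Unshelve. all: by end_near. Qed.

End RadialDerivatives.

(** * Linear combinations of smooth functions and of splines *)

Lemma derive1n_iter (R : realType) n (f : R -> R) :
  derive1n n f = iter n (fun h : R -> R => 'D_1 h) f.
Proof.
elim: n => [|n IHn]; first exact: derive1n0.
by rewrite derive1nS iterS -IHn; apply/funext => x; exact: derive1E.
Qed.

Section LinearCombinations.
Context {R : realType}.
Implicit Types (f g : R -> R) (U : set R).

Lemma Cn_upto_eq U n f g : open U -> (forall x, U x -> f x = g x) ->
  Cn_upto U n f -> Cn_upto U n g.
Proof.
move=> oU; elim: n f g => [|n IHn] f g fg [[F [cF fF]] df].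
  by split => //; exists F; split => // x Ux; rewrite -fg// fF.
split; first by exists F; split => // x Ux; rewrite -fg// fF.
have nfg x : U x -> \forall y \near x, f y = g y.
  by move=> Ux; near=> y; apply: fg; near: y; exact: open_nbhs_nbhs.
case: df => df cf; split=> [x Ux|v].
  apply/derivable1_diffP; apply: (near_eq_derivable (nfg _ Ux)).
  exact/derivable1_diffP/df.
by apply: IHn (cf v) => x Ux; apply: near_eq_derive; exact: nfg.
Unshelve. all: by end_near. Qed.

Lemma within_continuous_lin (A : set R) f g (a b : R) :
  {within A, continuous f} -> {within A, continuous g} ->
  {within A, continuous (fun x => a * f x + b * g x)}.
Proof.
move=> cf cg x; apply: cvgD; apply: cvgM;
  by [exact: cvg_cst|exact: cf|exact: cg].
Qed.

Lemma continuous_lin f g (a b x : R) :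
  {for x, continuous f} -> {for x, continuous g} ->
  {for x, continuous (fun y => a * f y + b * g y)}.
Proof.
by move=> cf cg; apply: cvgD; apply: cvgM; [exact: cvg_cst| |exact: cvg_cst|].
Qed.

Lemma derive_lin f g (a b x v : R) : derivable f x v -> derivable g x v ->
  'D_v (fun y => a * f y + b * g y) x = a * 'D_v f x + b * 'D_v g x.
Proof.
move=> df dg.
have := deriveD (derivableZ (k := a) df) (derivableZ (k := b) dg).
by rewrite !deriveZ.
Qed.

Lemma derivable_lin f g (a b x v : R) : derivable f x v -> derivable g x v ->
  derivable (fun y => a * f y + b * g y) x v.
Proof.
by move=> df dg; exact: (derivableD (derivableZ (k := a) df) (derivableZ (k := b) dg)).
Qed.

Lemma Cn_upto_lin U n f g (a b : R) : open U ->
  Cn_upto U n f -> Cn_upto U n g ->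
  Cn_upto U n (fun x => a * f x + b * g x).
Proof.
move=> oU; elim: n f g => [|n IHn] f g [[F [cF fF]] df] [[G [cG gG]] dg].
  split => //; exists (fun x => a * F x + b * G x); split.
    exact: within_continuous_lin.
  by move=> x Ux; rewrite fF// gG.
split.
  exists (fun x => a * F x + b * G x); split.
    exact: within_continuous_lin.
  by move=> x Ux; rewrite fF// gG.
case: df dg => df cf [dg cg].
split=> [x Ux|v].
  by apply/derivable1_diffP/derivable_lin; apply/derivable1_diffP; [exact: df|exact: dg].
apply: Cn_upto_eq (IHn _ _ (cf v) (cg v)) => // x Ux.
by rewrite derive_lin//; apply: diff_derivable; [exact: df|exact: dg].
Qed.

Lemma Cn_closure_lin U n f g (a b : R) : open U ->
  Cn_closure U n f -> Cn_closure U n g ->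
  Cn_closure U n (fun x => a * f x + b * g x).
Proof.
move=> oU [cf uf] [cg ug]; split; last exact: Cn_upto_lin.
exact: within_continuous_lin.
Qed.

Lemma derive1n_lin U n f g (a b x : R) : open U -> U x ->
  Cn_upto U n f -> Cn_upto U n g ->
  derive1n n (fun y => a * f y + b * g y) x =
  a * derive1n n f x + b * derive1n n g x.
Proof. by move=> oU Ux cf cg; rewrite !derive1n_iter (iter_derive_lin _ _ _ oU Ux). Qed.

Lemma Cn_upto_cst U n (c : R) : Cn_upto U n (fun=> c).
Proof.
elim: n c => [|n IHn] c.
  by split => //; exists (fun=> c); split => // x; exact: cvg_cst.
split; first by exists (fun=> c); split => // x; exact: cvg_cst.
split=> [x _|v]; first exact: differentiable_cst.
by rewrite (_ : 'D_v _ = fun=> 0)//; apply/funext => x; exact: derive_cst.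
Qed.

Lemma Cn_closure_sum U n (I : Type) (s : seq I) (b : I -> R) (F : I -> R -> R) :
  open U -> (forall i, Cn_closure U n (F i)) ->
  Cn_closure U n (fun x => \sum_(i <- s) b i * F i x).
Proof.
move=> oU cF; elim: s => [|i s IHs].
  under eq_fun do rewrite big_nil.
  by split; [move=> x; exact: cvg_cst|exact: Cn_upto_cst].
rewrite (_ : (fun x => _) = (fun x => b i * F i x + 1 * \sum_(j <- s) b j * F j x)).
  exact: Cn_closure_lin.
by apply/funext => x; rewrite big_cons mul1r.
Qed.

Lemma derive1n_sum U n (I : Type) (s : seq I) (b : I -> R) (F : I -> R -> R) x :
  open U -> U x -> (forall i, Cn_closure U n (F i)) ->
  derive1n n (fun y => \sum_(i <- s) b i * F i y) x =
  \sum_(i <- s) b i * derive1n n (F i) x.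
Proof.
move=> oU Ux cF; elim: s => [|i s IHs].
  under eq_fun do rewrite big_nil.
  rewrite big_nil; elim: n {cF} => // n IHn; rewrite derive1Sn.
  rewrite (_ : derive1 _ = fun=> 0)//; apply/funext => y.
  by rewrite derive1E derive_cst.
rewrite (_ : (fun x => _) = (fun x => b i * F i x + 1 * \sum_(j <- s) b j * F j x)); last first.
  by apply/funext => y; rewrite big_cons mul1r.
rewrite (derive1n_lin _ _ oU Ux) ?IHs ?big_cons ?mul1r//; first by case: (cF i).
by case: (Cn_closure_sum s b oU cF).
Qed.

End LinearCombinations.

Section SplineSpace.
Context {R : realType}.
Variables (N1 : nat) (knot : nat -> R).
Hypothesis knot_lt : forall i : nat, (i < N1)%N -> knot i < knot i.+1.

Lemma knot_ltn i j : (i < j <= N1)%N -> knot i < knot j.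
Proof.
elim: j => // j IHj /andP[ij jN].
have jj := knot_lt jN; have [lij|ji] := ltnP i j.
  by apply: lt_trans jj; apply: IHj; rewrite lij ltnW.
by rewrite (_ : i = j)//; apply/eqP; rewrite eqn_leq ji -ltnS ij.
Qed.

Lemma knot_leq i j : (i <= j <= N1)%N -> knot i <= knot j.
Proof.
by case: ltngtP => //= [ij jN|-> //]; apply/ltW/knot_ltn; rewrite ij.
Qed.

Local Notation U := (`]knot 0%N, knot N1[%classic : set R).

(** Near a point strictly between two knots the spline is a cubic, so its second derivative is there
    a polynomial. *)
Lemma derivable_derive2_spline (V : nat -> R) (s : R -> R) j x :
  not_a_knot_spline N1 knot V s -> (j < N1)%N -> knot j < x < knot j.+1 ->
  derivable (derive1n 2 s) x 1.
Proof.
move=> [_ /(_ j) pc _ _ _] /pc[p [_ pE]] xI.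
pose W : set R := `]knot j, knot j.+1[%classic.
have oW : open W by exact: interval_open.
apply: (@near_eq_derivable _ _ _ (horner (p^`())^`())); last exact: derivable_horner.
have Wx : W x by rewrite /W/= in_itv.
near=> y; have Wy : W y by near: y; exact: open_nbhs_nbhs.
rewrite !derivE derive1n_iter -[LHS]/(derive1n 2 (horner p) y) derive1n_iter.
apply: (iter_derive_eq _ _ oW Wy) => z.
by rewrite /W/= in_itv/= => /andP[z1 z2]; rewrite pE// !ltW.
Unshelve. all: by end_near. Qed.

(** Linearity of [derive1n 3] at a point requires both second derivatives to be derivable there.
    Near an interior knot this holds on either side, where the splines are cubics, and at the knot
    itself by assumption. *)
Lemma third_derivative_continuous_lin (V W : nat -> R) (s t : R -> R) (a b : R)
    (m : nat) : (0 < m < N1)%N ->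
  not_a_knot_spline N1 knot V s -> not_a_knot_spline N1 knot W t ->
  third_derivative_continuous_at s (knot m) ->
  third_derivative_continuous_at t (knot m) ->
  third_derivative_continuous_at (fun x => a * s x + b * t x) (knot m).
Proof.
move=> /andP[m0 mN] ss st [ds cs] [dt ct].
have mP : (m.-1 < N1)%N by rewrite prednK// ltnW.
have [[_ us] _ _ _ _] := ss; have [[_ ut] _ _ _ _] := st.
have oU : open U by exact: interval_open.
have near_lt : \forall y \near knot m, knot m.-1 < y < knot m.+1.
  have : nbhs (knot m) `]knot m.-1, knot m.+1[%classic.
    apply: open_nbhs_nbhs; split; first exact: interval_open.
    by rewrite /= in_itv/= knot_lt// -{2}(prednK m0) knot_lt.
  by apply: filterS => y; rewrite /= in_itv.
have inU y : knot m.-1 < y < knot m.+1 -> U y.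
  move=> /andP[y1 y2]; rewrite /= in_itv/= (le_lt_trans _ y1)/=; last first.
    by apply: knot_leq; rewrite leq0n ltnW.
  by rewrite (lt_le_trans y2)// knot_leq// mN/=.
have E2 : \forall y \near knot m, a * derive1n 2 s y + b * derive1n 2 t y =
    derive1n 2 (fun x => a * s x + b * t x) y.
  apply: filterS near_lt => y /inU Uy.
  by rewrite (derive1n_lin _ _ oU Uy us ut).
have der y : knot m.-1 < y < knot m.+1 ->
    derivable (derive1n 2 s) y 1 /\ derivable (derive1n 2 t) y 1.
  move=> /andP[y1 y2]; have [ym|ym|->//] := ltgtP y (knot m).
    have yI : knot m.-1 < y < knot m.-1.+1 by rewrite y1 prednK.
    by split; [exact: derivable_derive2_spline ss mP yI|exact: derivable_derive2_spline st mP yI].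
  have yI : knot m < y < knot m.+1 by rewrite ym.
  by split; [exact: derivable_derive2_spline ss mN yI|exact: derivable_derive2_spline st mN yI].
split.
  exact: (@near_eq_derivable R R R _ (derive1n 2 (fun x => a * s x + b * t x))
    (knot m) 1 E2 (derivable_lin ds dt)).
have E3 : \forall y \near knot m, a * derive1n 3 s y + b * derive1n 3 t y =
    derive1n 3 (fun x => a * s x + b * t x) y.
  near=> y.
  have [d1 d2] : derivable (derive1n 2 s) y 1 /\ derivable (derive1n 2 t) y 1.
    by apply: der; near: y.
  have D3 (h : R -> R) : derive1n 3 h y = 'D_1 (derive1n 2 h) y.
    by rewrite derive1nS; exact: derive1E.
  rewrite (D3 s) (D3 t) (D3 (fun x => a * s x + b * t x)) -(derive_lin a b d1 d2).
  apply: (@near_eq_derive R R R (fun z => a * derive1n 2 s z + b * derive1n 2 t z)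
    (derive1n 2 (fun x => a * s x + b * t x)) y 1).
  by near: y; move: E2; exact: nbhs_interior.
have E3m := nbhs_singleton E3.
rewrite /prop_for /continuous_at -E3m.
apply: cvg_trans; first exact: (near_eq_cvg E3).
exact: (continuous_lin (a := a) (b := b) cs ct).
Unshelve. all: by end_near. Qed.

Lemma not_a_knot_spline_lin (V W : nat -> R) (s t : R -> R) (a b : R) :
  (1 < N1)%N ->
  not_a_knot_spline N1 knot V s -> not_a_knot_spline N1 knot W t ->
  not_a_knot_spline N1 knot (fun j => a * V j + b * W j)
    (fun x => a * s x + b * t x).
Proof.
move=> N1gt ss st.
have [cs ps vs s1 sN] := ss; have [ct pt vt t1 tN] := st; split.
- by apply: Cn_closure_lin => //; exact: interval_open.
- move=> j jN; have [p [sp pE]] := ps j jN; have [q [sq qE]] := pt j jN.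
  exists (a *: p + b *: q); split.
    rewrite (leq_trans (size_polyD _ _))// geq_max.
    by rewrite (leq_trans (size_scale_leq _ _))// (leq_trans (size_scale_leq _ _)).
  by move=> x xI; rewrite pE// qE// hornerD !hornerZ.
- by move=> j jN; rewrite vs// vt.
(* [1 < N1] makes the knots of index [1] and [N1 - 1] interior. *)
- exact: (third_derivative_continuous_lin a b _ ss st).
- by apply: (third_derivative_continuous_lin a b _ ss st) => //; lia.
Qed.

End SplineSpace.

(** * Essential suprema *)

Section EssentialBounds.
Context {R : realType}.
Local Notation mu := (@lebesgue_measure R).
Local Notation mu2 := (mu \x mu)%E.

(** Balls of the product are squares, and a square of side [2e] has positive area. *)
Lemma nbhs_not_negligible (p : R * R) (S : set (R * R)) :
  nbhs p S -> ~ mu2.-negligible S.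
Proof.
move=> /nbhs_ballP[e/= e0 eS] [A [mA A0 SA]].
pose B : set (R * R) := (ball p.1 e) `*` (ball p.2 e).
have mB : measurable B by apply: measurableX; exact: measurable_ball.
have BA : B `<=` A by move=> q [q1 q2]; apply/SA/eS.
have : (mu2 B <= mu2 A)%E by apply: le_measure => //; rewrite inE.
rewrite A0 product_measure1E//; try exact: measurable_ball.
have mb x : (mu (ball x e) = (e *+ 2)%:E)%E by rewrite lebesgue_measure_ball// ltW.
have -> : ((mu (ball p.1 e) * mu (ball p.2 e)) = (e *+ 2 * (e *+ 2))%:E)%E by rewrite !mb.
by rewrite lee_fin leNgt mulr_gt0// mulrn_wgt0.
Qed.

(** If [|u p|] exceeded the essential supremum, so would [|u|] on a whole neighbourhood of [p],
    which is not negligible. *)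
Lemma le_Linfty_continuous (D : set (R * R)) (u : R * R -> R) (p : R * R) :
  nbhs p D -> {for p, continuous u} -> (`|u p|%:E <= Linfty mu2 D u)%E.
Proof.
move=> nD cu; rewrite /Linfty unlock.
case: ifPn => [_|]; last first.
  (* The norm is defined by cases on whether the whole space has positive measure; the plane
     does. *)
  rewrite -leNgt => mu0; exfalso.
  apply: (@nbhs_not_negligible p setT); first exact: filterT.
  exists setT; split => //; apply/eqP; rewrite eq_le mu0/=; exact: measure_ge0.
rewrite leNgt; apply/negP => uL.
apply: (@nbhs_not_negligible p [set q | ~ (abse (((EFin \o u) \_ D) q) <=
    ess_sup mu2 (abse \o (EFin \o u) \_ D))%E]); last first.
  exact: ess_sup_ge.
(* A finite level is chosen because the essential supremum is an extended real, a priori possibly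
   [-oo]. *)
have [L LE Lu] : exists2 L : R, (ess_sup mu2 (abse \o (EFin \o u) \_ D) <= L%:E)%E & L < `|u p|.
  move: uL; case: (ess_sup _ _) => [r|//|] rp.
    by exists r => //; rewrite -lte_fin.
  by exists (`|u p| - 1); rewrite ?leNye// ltrBlDr ltrDl.
have cn : {for p, continuous (fun q => `|u q|)}.
  by apply: (@continuous_comp _ _ _ u (@Num.norm _ R)) => //; exact: norm_continuous.
have nL : \forall q \near p, L < `|u q|.
  have : nbhs `|u p| [set x | L < x].
    by apply: open_nbhs_nbhs; split => //; exact: open_gt.
  by move=> /cn.
near=> q => /=; rewrite patchE mem_set; last by near: q.
rewrite /=; apply/negP; rewrite -ltNge; apply: (le_lt_trans LE).
by rewrite lte_fin; near: q.
Unshelve. all: by end_near. Qed.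

(** The endpoints form a null set, and outside the interval the restricted function is 0, which is
    at most [B]. Derivatives are thus only controlled on the open interval. *)
Lemma Linfty_le (a b : R) (u : R -> R) (B : \bar R) : (0 <= B)%E ->
  (forall x, a < x < b -> (`|u x|%:E <= B)%E) ->
  (Linfty mu `[a, b] u <= B)%E.
Proof.
move=> B0 uB; rewrite /Linfty unlock; case: ifPn => // _.
apply/ess_supP; exists [set a; b]; split.
- exact: measurableU.
- apply: countable_lebesgue_measure0; apply: finite_set_countable.
  exact: finite_set2.
- move=> x /= /negP; rewrite -ltNge patchE; case: ifPn; last by rewrite abse0 ltNge B0.
  rewrite inE/= in_itv/= => /andP[]; rewrite !le_eqVlt => /orP[/eqP ->|ax]; first by left.
  move=> /orP[/eqP ->|xb]; first by right.
  by rewrite ltNge uB// ax.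
Qed.

End EssentialBounds.

(** * Discrete orthogonality *)

Section TrigonometricSums.
Context {R : realType}.

(* [2 sin (theta / 2) cos (s theta - p)] telescopes; [p = 0] and [p = pi / 2]
   give the cosine and the sine sums. *)
Lemma sum_cos_equidistributed (M k : nat) (p : R) : (0 < k < M)%N ->
  \sum_(1 <= s < M.+1) cos (k%:R * (2 * pi * s%:R / M%:R) - p) = 0.
Proof.
move=> /andP[k0 kM]; have M0 : M%:R != 0 :> R by rewrite pnatr_eq0; lia.
have M1 : (0 < M)%N by lia.
have M0' : 0 < M%:R :> R by rewrite ltr0n.
pose th : R := k%:R * (2 * pi / M%:R).
pose F (s : nat) := sin (s%:R * th - th / 2 - p).
have E (s : nat) : 2 * sin (th / 2) * cos (k%:R * (2 * pi * s%:R / M%:R) - p) = F s.+1 - F s.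
  have -> : k%:R * (2 * pi * s%:R / M%:R) - p = s%:R * th - p.
    by rewrite /th; field.
  have -> : F s.+1 = sin ((s%:R * th - p) + th / 2).
    by rewrite /F; congr sin; rewrite -natr1; field.
  have -> : F s = sin ((s%:R * th - p) - th / 2) by rewrite /F; congr sin; ring.
  by rewrite (sinD (s%:R * th - p)) (sinB (s%:R * th - p)); ring.
(* [th / 2 = pi k / M] lies strictly between 0 and [pi] because [0 < k < M], so this factor can be
   cancelled. *)
have s0 : 0 < sin (th / 2).
  have -> : th / 2 = pi * (k%:R / M%:R) by rewrite /th; field.
  apply: sin_gt0_pi; rewrite mulr_gt0 ?pi_gt0 ?divr_gt0 ?ltr0n//=.
  by rewrite -[ltRHS]mulr1 ltr_pM2l ?pi_gt0// ltr_pdivrMr// mul1r ltr_nat.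
suff /eqP : 2 * sin (th / 2) * \sum_(1 <= s < M.+1)
    cos (k%:R * (2 * pi * s%:R / M%:R) - p) = 0.
  have c0 : 0 < 2 * sin (th / 2) by apply: mulr_gt0 => //; exact: s0.
  by rewrite mulf_eq0 (gt_eqF c0) => /eqP.
rewrite mulr_sumr (eq_bigr _ (fun s _ => E s)) telescope_sumr//.
(* From [1] to [M + 1] the argument grows by [M th = 2 pi k], that is, by [k] full periods. *)
have -> : F M.+1 = F 1%N; last by rewrite subrr.
have pk : pi *+ 2 *+ k = k%:R * (2 * pi) :> R.
  by rewrite -(mulr_natr (pi *+ 2)) -(mulr_natr pi); ring.
rewrite /F -[RHS](periodicn (@sinD2pi R) k) pk; congr sin.
by rewrite -natr1 /th; field.
Qed.

Lemma sum_Y_eq0 (M k l : nat) : (0 < k < M)%N ->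
  \sum_(1 <= s < M.+1) Y k l (2 * pi * s%:R / M%:R) = 0 :> R.
Proof.
move=> kM; have /negPf k0 : k != 0%N by lia.
have [l1|l1] := eqVneq l 1%N.
  transitivity ((Num.sqrt pi)^-1 * \sum_(1 <= s < M.+1)
    cos (k%:R * (2 * pi * s%:R / M%:R) - 0) : R).
    by rewrite mulr_sumr; apply: eq_bigr => s _; rewrite /Y k0 l1 subr0.
  by rewrite sum_cos_equidistributed// mulr0.
transitivity ((Num.sqrt pi)^-1 * \sum_(1 <= s < M.+1)
  cos (k%:R * (2 * pi * s%:R / M%:R) - pi / 2) : R).
  by rewrite mulr_sumr; apply: eq_bigr => s _; rewrite /Y k0 (negPf l1) cosBpihalf.
by rewrite sum_cos_equidistributed// mulr0.
Qed.

Lemma normr_Y_le k l (x : R) : `|Y k l x| <= (Num.sqrt pi)^-1.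
Proof.
have p0 : 0 < Num.sqrt pi :> R by rewrite sqrtr_gt0 pi_gt0.
rewrite /Y; case: ifP => _.
  rewrite ger0_norm ?invr_ge0 ?sqrtr_ge0// lef_pV2 ?posrE ?sqrtr_gt0 ?mulr_gt0 ?pi_gt0//.
  by rewrite ler_wsqrtr// -[leLHS]mul1r ler_pM2r ?pi_gt0// ler1n.
by case: ifP => _; rewrite normrM (ger0_norm (x := _^-1)) ?invr_ge0 ?sqrtr_ge0//;
  rewrite ler_piMr ?invr_ge0 ?sqrtr_ge0 ?cos_max ?sin_max.
Qed.

End TrigonometricSums.

(** * The Gauss weights *)

Section GaussBound.
Context {R : realType}.
Local Notation mu := (@lebesgue_measure R).

Lemma powR_half_nat (x : R) k : 0 <= x -> x `^ (k%:R / 2) = Num.sqrt x ^+ k.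
Proof. by move=> x0; rewrite mulrC powRrM powR12_sqrt// powR_mulrn// sqrtr_ge0. Qed.

Lemma sqrt_cone_sqrtV k : sqrt_cone (fun x : R => (Num.sqrt x)^-1 ^+ k).
Proof.
elim: k => [|k IHk]; first by under eq_fun do rewrite expr0; exact: sqrt_cone_cst.
rewrite (_ : (fun x => _) = (fun x => (Num.sqrt x)^-1 ^+ k / (Num.sqrt x + 0))).
  exact: sqrt_cone_div.
by apply/funext => x; rewrite addr0 exprSr.
Qed.

(** Negation exchanges the positive and negative parts. No integrability is assumed: [fine] sends
    every infinite value to 0 on both sides. *)
Lemma RintegralN (D : set R) (f : R -> R) :
  \int[mu]_(x in D) (- f x) = - \int[mu]_(x in D) f x.
Proof.
have E1 := integralE mu D (fun x => (- (f x)%:E)%E).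
have E2 := integralE mu D (fun x => (f x)%:E).
have p0 : (0 <= \int[mu]_(x in D) (fun x => (f x)%:E)^\+ x)%E by exact: integral_ge0.
have n0 : (0 <= \int[mu]_(x in D) (fun x => (f x)%:E)^\- x)%E by exact: integral_ge0.
have P : ((fun x => - (f x)%:E)^\+ = (fun x => (f x)%:E)^\-)%E by exact: funeposN.
have Q : ((fun x => - (f x)%:E)^\- = (fun x => (f x)%:E)^\+)%E by exact: funenegN.
rewrite P Q in E1.
transitivity (fine (\int[mu]_(x in D) (- (f x)%:E))%E); first by [].
rewrite E1 /Rintegral E2; move: p0 n0.
move: (integral _ _ _) (integral _ _ _) => [a| |] [c| |]//= _ _; rewrite ?oppr0//.
by rewrite opprB.
Qed.

(* The measure is [rho^(k/2) W(sqrt rho) / 2 drho], and [rho^(-k/2)] is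
   underestimated by its Gauss quadrature. *)
Lemma gauss_sum_le (b : R) (W : R -> R) (N k : nat) (t lambda : nat -> R) :
  0 < b -> (0 < N)%N ->
  measurable_fun `[0, b] W -> (forall r, 0 <= r <= b -> 0 <= W r) ->
  (\int[mu]_(r in `[0%R, b]) (W r * r)%:E < +oo)%E ->
  (forall i j : nat, (i < j < N)%N -> t i < t j) ->
  (forall j : nat, (j < N)%N -> 0 < t j < b ^+ 2) ->
  (forall s : nat, (s <= 2 * N - 1)%N ->
    \sum_(j < N) lambda j * t j ^+ s =
    2^-1 * \int[mu]_(x in `[0, b ^+ 2]) (x ^+ s * x `^ (k%:R / 2) * W (Num.sqrt x))) ->
  (forall j, (j < N)%N -> 0 <= lambda j) /\
  ((\sum_(j < N) lambda j * t j `^ (- (k%:R / 2)))%:E <=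
   \int[mu]_(r in `[0%R, b]) (W r * r)%:E)%E.
Proof.
move=> b0 N0 mW W0 intW t_lt t_b moments.
have intE := ge0_integral_comp_sqrt (ltW b0) mW W0.
set I := (\int[mu]_(r in `[0%R, b]) (W r * r)%:E)%E in intW intE *.
have I0 : (0 <= I)%E.
  apply: integral_ge0 => r /=; rewrite in_itv/= => /andP[r0 rb].
  by rewrite lee_fin mulr_ge0// W0// r0.
have If : I \is a fin_num by rewrite ge0_fin_numE.
pose D : set R := `]0, b ^+ 2]%classic.
have mD : measurable D by exact: measurable_itv.
have sqrtI x : D x -> 0 <= Num.sqrt x <= b.
  rewrite /D/= in_itv/= => /andP[x0 xb]; rewrite sqrtr_ge0/=.
  by rewrite -(ger0_norm (ltW b0)) -sqrtr_sqr ler_wsqrtr.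
pose V x := W (Num.sqrt x).
have V0 x : D x -> 0 <= V x by move=> /sqrtI; exact: W0.
have iV : mu.-integrable D (EFin \o V).
  apply/integrableP; split.
    apply/measurable_EFinP; apply: (@measurable_comp _ _ _ _ _ _ `[0, b]) => //.
      by move=> _ [y + <-]; rewrite /= in_itv/=; exact: sqrtI.
    by apply: measurable_funTS; apply: continuous_measurable_fun; exact: sqrt_continuous.
  have -> : (\int[mu]_(x in D) `|(EFin \o V) x| = \int[mu]_(x in D) (V x)%:E)%E.
    by apply: eq_integral => x; rewrite inE => Dx; rewrite /= ger0_norm// V0.
  by rewrite intE lte_mul_pinfty.
(* The density of the Gauss measure is [g V]; continuity of [g] makes it integrable as soon as [V]
   is. *)
pose g (x : R) := 2^-1 * Num.sqrt x ^+ k.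
have cg : continuous g.
  move=> x; apply: cvgM; first exact: cvg_cst.
  apply: (@continuous_comp _ _ _ (@Num.sqrt R) (fun y : R => y ^+ k)).
    exact: sqrt_continuous.
  exact: exprn_continuous.
pose omega x := g x * V x.
have iomega : mu.-integrable D (EFin \o omega) by exact: integrable_continuous_mul.
have omega0 x : D x -> 0 <= omega x.
  by move=> Dx; rewrite !mulr_ge0 ?V0 ?exprn_ge0 ?sqrtr_ge0// invr_ge0.
have t0 j : (j < N)%N -> 0 < t j by move=> /t_b /andP[].
have exact_monomial s : (s < 2 * N)%N ->
    \sum_(j < N) lambda j * t j ^+ s = \int[mu]_(x in D) (x ^+ s * omega x).
  move=> sN; rewrite moments; last by lia.
  have E x : D x -> x ^+ s * omega x =
      2^-1 * (x ^+ s * x `^ (k%:R / 2) * W (Num.sqrt x)).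
    rewrite /D/= in_itv/= => /andP[x0 _]; rewrite powR_half_nat ?ltW//.
    by rewrite /omega /g /V; ring.
  have i1 : mu.-integrable D (EFin \o (fun x => x ^+ s * Num.sqrt x ^+ k * V x)).
    apply: integrable_continuous_mul => // x; apply: cvgM.
      exact: exprn_continuous.
    apply: (@continuous_comp _ _ _ (@Num.sqrt R) (fun y : R => y ^+ k)).
      exact: sqrt_continuous.
    exact: exprn_continuous.
  have i2 : mu.-integrable D (EFin \o (fun x => x ^+ s * x `^ (k%:R / 2) * W (Num.sqrt x))).
    apply: eq_integrable i1 => // x; rewrite inE /D/= in_itv/= => /andP[x0 _].
    by rewrite powR_half_nat ?ltW.
  rewrite -Rintegral_itv_obnd_cbnd// -RintegralZl//.
  by apply: eq_Rintegral => x; rewrite inE => Dx; rewrite E.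
split.
  by move=> j jN; exact: (gauss_weight_ge0 omega0 iomega t_lt exact_monomial).
have -> : \sum_(j < N) lambda j * t j `^ (- (k%:R / 2)) =
    \sum_(j < N) lambda j * (Num.sqrt (t j))^-1 ^+ k.
  apply: eq_bigr => j _; congr (_ * _).
  by rewrite powRN powR_half_nat ?exprVn// ltW// t0.
have iv : mu.-integrable D (EFin \o (fun x => 2^-1 * V x)).
  by apply: integrable_continuous_mul => // x; exact: cvg_cst.
(* The powers of [sqrt x] cancel. The factor 1/2 left in the majorant is compensated by the 2 of the
   substitution [y = r^2]. *)
have uv x : D x -> (Num.sqrt x)^-1 ^+ k * omega x <= 2^-1 * V x.
  rewrite /D/= in_itv/= => /andP[x0 _].
  rewrite /omega /g mulrA mulrCA exprVn mulVf ?mulr1//.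
  by rewrite expf_neq0// gt_eqF// sqrtr_gt0.
rewrite -(fineK If) lee_fin.
apply: le_trans (gauss_le_integral omega0 iomega t0 exact_monomial (sqrt_cone_sqrtV k) iv uv) _.
by rewrite RintegralZl// /Rintegral intE fineM//= mulrA mulVf ?mul1r.
Qed.

(** A nonpositive coefficient is reduced to a nonnegative one by negating it together with the Gauss
    weights, which preserves the moment identities. Each integral is finite as a single term of the
    convergent series of nonnegative terms. *)
Lemma gauss_quadrature_sum_le (Rad : R) (w : R * R -> R) (N k l : nat)
    (t lambda : nat -> R) : 0 < Rad -> (0 < N)%N -> (1 <= l <= a_ k)%N ->
  has_fourier Rad w -> pseudo_definite Rad w ->
  (weight_norm Rad w < +oo)%E ->
  gauss_quadrature Rad w N k l t lambda ->
  ((\sum_(j < N) `|lambda j| * t j `^ (- (k%:R / 2)))%:E <=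
   \int[mu]_(r in `[0%R, Rad]) (`|fourier w k l r| * r)%:E)%E.
Proof.
move=> Rad0 N0 lk [_ /(_ k l lk) mw] /(_ k l lk) pd wn [t_lt t_b moments].
have term0 k' l' : (0 <= \int[mu]_(r in `[0%R, Rad]) (`|fourier w k' l' r| * r)%:E)%E.
  apply: integral_ge0 => r /=; rewrite in_itv/= => /andP[r0 rb].
  by rewrite lee_fin mulr_ge0.
have wt0 k' : (0 <= weight_term Rad w k')%E by apply: sume_ge0 => l' _; exact: term0.
have fin : (\int[mu]_(r in `[0%R, Rad]) (`|fourier w k l r| * r)%:E < +oo)%E.
  apply: le_lt_trans wn; apply: (@le_trans _ _ (weight_term Rad w k)).
    rewrite /weight_term (bigD1_seq l)/= ?iota_uniq ?mem_index_iota//.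
    by rewrite leeDl// sume_ge0.
  apply: le_trans (nneseries_lim_ge k.+1 _); last by move=> *; exact: wt0.
  by rewrite big_nat_recr//= leeDr// sume_ge0.
have [w0|w0] := pd.
  have E : (\int[mu]_(r in `[0%R, Rad]) (`|fourier w k l r| * r)%:E =
      \int[mu]_(r in `[0%R, Rad]) (fourier w k l r * r)%:E)%E.
    apply: eq_integral => r; rewrite inE/= in_itv/= => rI.
    by rewrite ger0_norm ?w0.
  rewrite E in fin *.
  have [l0] := gauss_sum_le Rad0 N0 mw w0 fin t_lt t_b moments.
  by under [X in (X%:E <= _)%E -> _]eq_bigr => j _ do rewrite -(ger0_norm (l0 _ (ltn_ord j))).
have E : (\int[mu]_(r in `[0%R, Rad]) (`|fourier w k l r| * r)%:E =
    \int[mu]_(r in `[0%R, Rad]) (- fourier w k l r * r)%:E)%E.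
  apply: eq_integral => r; rewrite inE/= in_itv/= => rI.
  by rewrite ler0_norm ?w0.
rewrite E in fin *.
have Nw0 r : 0 <= r <= Rad -> 0 <= - fourier w k l r by move=> rI; rewrite oppr_ge0 w0.
have mNw : measurable_fun `[0, Rad] (fun r => - fourier w k l r).
  exact: measurableT_comp.
have Nmoments s : (s <= 2 * N - 1)%N -> \sum_(j < N) - lambda j * t j ^+ s =
    2^-1 * \int[mu]_(x in `[0, Rad ^+ 2])
      (x ^+ s * x `^ (k%:R / 2) * - fourier w k l (Num.sqrt x)).
  move=> sN; under eq_bigr do rewrite mulNr.
  rewrite sumrN moments// -mulrN; congr (_ * _).
  by rewrite -RintegralN; apply: eq_Rintegral => x _; rewrite mulrN.
have [l0] := gauss_sum_le (lambda := fun j => - lambda j) Rad0 N0 mNw Nw0 fin t_lt t_b Nmoments.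
rewrite (eq_bigr (fun j : 'I_N => `|lambda j| * t j `^ (- (k%:R / 2))))// => j _.
by rewrite -normrN ger0_norm// l0.
Qed.

End GaussBound.

(** * The interpolation error *)

Section SplineError.
Context {R : realType}.
Implicit Types (f : R * R -> R[i]) (z : R[i]).

Lemma lin_sum (I : Type) (s : seq I) (a b : R) (c u v : I -> R) :
  a * (\sum_(i <- s) c i * u i) + b * (\sum_(i <- s) c i * v i) =
  \sum_(i <- s) c i * (a * u i + b * v i).
Proof. by rewrite !mulr_sumr -big_split/=; apply: eq_bigr => i _; ring. Qed.

Lemma normc_ge0 z : 0 <= Normc.normc z.
Proof. by case: z => a b; exact: sqrtr_ge0. Qed.

(** The number [a - i b] is the conjugate of [z] divided by [|z|], or 1 if [z = 0]; the right-hand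
    side is the real part of its product with [z]. *)
Lemma normc_rotate z : exists a b : R, a ^+ 2 + b ^+ 2 = 1 /\
  Normc.normc z = a * complex.Re z + b * complex.Im z.
Proof.
case: z => x y /=; set n := Num.sqrt _.
have [n0|n0] := eqVneq n 0.
  exists 1, 0; rewrite expr1n expr0n addr0 mul0r mul1r addr0; split => //.
  apply/eqP; rewrite n0 eq_sym -sqrf_eq0 eq_le sqr_ge0 andbT.
  have /eqP := n0; rewrite sqrtr_eq0; apply: le_trans.
  by rewrite lerDl sqr_ge0.
have nE : n ^+ 2 = x ^+ 2 + y ^+ 2 by rewrite sqr_sqrtr// addr_ge0 ?sqr_ge0.
exists (x / n), (y / n); split.
  by rewrite !exprMn -mulrDl -nE exprVn divff// expf_neq0.
rewrite mulrAC [X in _ + X]mulrAC -mulrDl -!expr2 -nE expr2 mulfK//.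
Qed.

(** Lagrange's identity: [(a^2 + b^2)(x^2 + y^2) - (a x + b y)^2 = (a y - b x)^2]. *)
Lemma normr_lin_le_normc (a b x y : R) : a ^+ 2 + b ^+ 2 = 1 ->
  `|a * x + b * y| <= Normc.normc (Complex x y).
Proof.
move=> ab; rewrite /= -sqrtr_sqr ler_wsqrtr// -subr_ge0.
rewrite (_ : _ - _ = (a * y - b * x) ^+ 2) ?sqr_ge0//.
rewrite -[X in X - _]mul1r -ab; ring.
Qed.

Lemma le_Linfty_closed_disc (Rad phi r : R) n f :
  Cinfty_closed_disc Rad f -> 0 < r < Rad ->
  ((Normc.normc (radial_derive n f (polar r phi)))%:E <=
   Linfty_closed_disc Rad (radial_derive n f))%E.
Proof.
move=> /(_ n) [[_ cRe] [_ cIm]] rI.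
have := @le_Linfty_continuous R (closed_disc Rad)
  (fun p => Normc.normc (radial_derive n f p)) (polar r phi).
rewrite ger0_norm ?normc_ge0//; apply.
  have : nbhs (polar r phi) (disc Rad).
    by apply: open_nbhs_nbhs; split; [exact: open_disc|exact: disc_ray].
  by apply: filterS => p /ltW.
exact: (continuous_radial_derive cRe cIm rI).
Qed.

Definition dft_node M (s : nat) : R := 2 * pi * s%:R / M%:R.
Definition dft_coef M k l (s : nat) : R := 2 * pi / M%:R * Y k l (dft_node M s).

Lemma dftE M f k l r : dft M f k l r =
  Complex (\sum_(1 <= s < M.+1) dft_coef M k l s * complex.Re (f (polar r (dft_node M s))))
          (\sum_(1 <= s < M.+1) dft_coef M k l s * complex.Im (f (polar r (dft_node M s)))).
Proof.
rewrite /dft mulr_sumr; elim: (index_iota 1 M.+1) => [|s u IHu].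
  by rewrite !big_nil.
rewrite !big_cons IHu /dft_coef -/(dft_node M s).
case: (f (polar r (dft_node M s))) => x y; apply/eqP; rewrite eq_complex /=.
by apply/andP; split; apply/eqP; ring.
Qed.

(** There are [M] terms, each at most [(2 pi / M) / sqrt pi]. The factor 1/2 of the cubature later
    turns this bound into [sqrt pi]. *)
Lemma sum_dft_coef_le M k l : (0 < M)%N ->
  \sum_(1 <= s < M.+1) `|dft_coef M k l s| <= 2 * Num.sqrt pi.
Proof.
move=> M0; have M1 : 0 < M%:R :> R by rewrite ltr0n.
have p0 : 0 < Num.sqrt pi :> R by rewrite sqrtr_gt0 pi_gt0.
have pE : pi = Num.sqrt pi ^+ 2 :> R by rewrite sqr_sqrtr// pi_ge0.
apply: (@le_trans _ _ (\sum_(1 <= s < M.+1) (2 * pi / M%:R * (Num.sqrt pi)^-1 : R))).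
  apply: ler_sum => s _; rewrite /dft_coef normrM ger0_norm.
    by rewrite ler_wpM2l ?normr_Y_le// divr_ge0// mulr_ge0// pi_ge0.
  by rewrite divr_ge0// mulr_ge0// pi_ge0.
rewrite sumr_const_nat subn1/= -mulr_natr {1}pE le_eqVlt; apply/orP; left.
by apply/eqP; field; rewrite !gt_eqF.
Qed.

Lemma spline_data_dft M f (knot : nat -> R) k l j :
  (0 < M)%N -> knot 0%N = 0 -> (0 < k < M)%N \/ k = 0%N \/ f (0, 0) = 0 ->
  spline_data M f knot k l j = dft M f k l (knot j).
Proof.
move=> M0 knot0 kM; rewrite /spline_data; case: j => [|j]//=.
have M1 : M%:R != 0 :> R by rewrite pnatr_eq0; lia.
rewrite knot0 /dft.
have -> : \sum_(1 <= s < M.+1) f (polar 0 (2 * pi * s%:R / M%:R)) *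
      ((Y k l (2 * pi * s%:R / M%:R))%:C)%C =
    f (0, 0) * ((\sum_(1 <= s < M.+1) Y k l (2 * pi * s%:R / M%:R))%:C)%C.
  rewrite (rmorph_sum (real_complex R)) mulr_sumr; apply: eq_bigr => s _.
  by rewrite /polar !mul0r.
have [->|k0] := eqVneq k 0%N.
  pose q : R := Num.sqrt (2 * pi); pose d : R := 2 * pi.
  have q0 : q != 0 by rewrite gt_eqF// sqrtr_gt0 mulr_gt0// pi_gt0.
  have qE : d = q ^+ 2 by rewrite sqr_sqrtr// mulr_ge0// pi_ge0.
  (* For [k = 0] all samples equal [1 / q], so the sum is [M / q], and [d / q = q] because
     [d = q^2]. *)
  have S0 : q = d / M%:R * \sum_(1 <= s < M.+1) Y 0 l (2 * pi * s%:R / M%:R).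
    rewrite (eq_bigr (fun=> q^-1)) => [|s _]; last by rewrite /Y.
    rewrite sumr_const_nat subn1/= -(mulr_natr q^-1) qE; move: q0 M1; clearbody q; clear qE.
    by move: q (M%:R : R) => u v u0 v0; field; rewrite v0 u0.
  rewrite -[LHS]/(real_complex R q * f (0, 0)) (congr1 (real_complex R) S0).
  have CA (u v z : R[i]) : u * v * z = u * (z * v) by rewrite -mulrA (mulrC v).
  rewrite (rmorphM (real_complex R) (d / M%:R)); exact: CA.
case: kM => [kM|[k1|f0]].
- by rewrite sum_Y_eq0// !mulr0.
- by rewrite k1 eqxx in k0.
- by rewrite f0 mul0r mulr0.
Qed.

Lemma spline_error (Rad C x : R) f (M N1 k l : nat) (knot : nat -> R)
    (s : R -> R[i]) :
  0 < Rad -> (0 < M)%N -> (5 <= N1)%N -> grid 0 Rad N1 knot ->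
  Cinfty_closed_disc Rad f -> not_a_knot_constant 0 Rad C ->
  not_a_knot_splineC N1 knot (fun j => dft M f k l (knot j)) s ->
  0 <= x <= Rad ->
  ((Normc.normc (s x - dft M f k l x))%:E <=
   (2 * Num.sqrt pi * C * mesh N1 knot ^+ 4)%:E
   * Linfty_closed_disc Rad (radial_derive 4 f))%E.
Proof.
move=> Rad0 M0 N5 gr smooth [C0 CP] [sRe sIm] xI.
set B := Linfty_closed_disc Rad (radial_derive 4 f).
have [knot0 knotN knot_lt] := gr.
(* The rotation is chosen for the fixed point [x] and kept constant in [r], so that it commutes with
   differentiation and interpolation. *)
have [a [b [ab nE]]] := normc_rotate (s x - dft M f k l x).
pose Fre (i : nat) r := complex.Re (f (polar r (dft_node M i))).
pose Fim (i : nat) r := complex.Im (f (polar r (dft_node M i))).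
pose I := index_iota 1 M.+1.
pose c := dft_coef M k l.
pose G r := a * (\sum_(i <- I) c i * Fre i r) + b * (\sum_(i <- I) c i * Fim i r).
pose S r := a * complex.Re (s r) + b * complex.Im (s r).
have oU : open (`]0, Rad[%classic : set R) by exact: interval_open.
have cFre n i : Cn_closure (`]0, Rad[ : set R) n (Fre i).
  by case: (smooth n) => cf _; exact: (Cn_closure_ray (dft_node M i) Rad0 cf).
have cFim n i : Cn_closure (`]0, Rad[ : set R) n (Fim i).
  by case: (smooth n) => _ cf; exact: (Cn_closure_ray (dft_node M i) Rad0 cf).
have cG : Cn_closure (`]0, Rad[ : set R) 4 G.
  by apply: Cn_closure_lin => //; apply: Cn_closure_sum.
have spS : not_a_knot_spline N1 knot (fun j => G (knot j)) S.
  have := not_a_knot_spline_lin knot_lt a b (ltn_trans (isT : (1 < 4)%N) N5) sRe sIm.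
  rewrite (_ : (fun j => _) = (fun j => G (knot j)))//.
  by apply/funext => j; rewrite !dftE.
have := CP N1 knot G S N5 gr cG spS x xI.
have -> : `|G x - S x| = Normc.normc (s x - dft M f k l x).
  rewrite -[RHS]ger0_norm ?normc_ge0// nE -normrN; congr `|_|.
  rewrite dftE /G /S; case: (s x) => u v /=; ring.
move=> H; apply: (le_trans H).
have B0 : (0 <= B)%E.
  apply: le_trans (le_Linfty_closed_disc 0 (r := Rad / 2) 4 smooth _).
    by rewrite lee_fin normc_ge0.
  by rewrite divr_gt0//= ltr_pdivrMr// ltr_pMr// ltr1n.
have L : (Linfty lebesgue_measure `[0%R, Rad] (derive1n 4 G) <=
    (2 * Num.sqrt pi)%:E * B)%E.
  apply: Linfty_le => [|r rI].
    by rewrite mule_ge0// lee_fin mulr_ge0// sqrtr_ge0.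
  have Ur : (`]0, Rad[%classic : set R) r by rewrite /= in_itv.
  have r0 : 0 < r by case/andP: rI.
  have -> : derive1n 4 G r =
      \sum_(i <- I) c i * (a * derive1n 4 (Fre i) r + b * derive1n 4 (Fim i) r).
    have [_ u1] := Cn_closure_sum I c oU (cFre 4).
    have [_ u2] := Cn_closure_sum I c oU (cFim 4).
    rewrite (derive1n_lin a b oU Ur u1 u2).
    rewrite (derive1n_sum I c oU Ur (cFre 4)) (derive1n_sum I c oU Ur (cFim 4)).
    exact: (lin_sum I a b c (fun i => derive1n 4 (Fre i) r) (fun i => derive1n 4 (Fim i) r)).
  (* Real and imaginary parts are kept together along each ray, so the modulus of the complex radial
     derivative suffices, without a factor [sqrt 2]. *)
  have bound i : ((`|a * derive1n 4 (Fre i) r + b * derive1n 4 (Fim i) r|)%:E <= B)%E.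
    apply: le_trans (le_Linfty_closed_disc (dft_node M i) 4 smooth rI).
    by rewrite lee_fin radial_derive_polar//; exact: normr_lin_le_normc.
  (* If [B = +oo] the bound is trivial, since its coefficient is positive. *)
  move: B0 bound; case: B => [B|_ _|//]; last first.
    by rewrite gt0_muley ?leey// lte_fin mulr_gt0// sqrtr_gt0 pi_gt0.
  rewrite lee_fin => B0 bound; rewrite -EFinM lee_fin.
  apply: (@le_trans _ _ (\sum_(i <- I) `|c i| * B)).
    apply: (le_trans (ler_norm_sum _ _ _)); apply: ler_sum => i _.
    by rewrite normrM ler_wpM2l//; have := bound i; rewrite lee_fin.
  by rewrite -mulr_suml ler_wpM2r// sum_dft_coef_le.
have h0 : 0 <= mesh N1 knot ^+ 4.
  by rewrite exprn_even_ge0.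
rewrite (_ : 2 * Num.sqrt pi * C * _ = C * (2 * Num.sqrt pi) * mesh N1 knot ^+ 4); last by ring.
apply: (@le_trans _ _
    (C%:E * ((2 * Num.sqrt pi)%:E * B) * (mesh N1 knot ^+ 4)%:E)%E).
  by rewrite lee_wpmul2r ?lee_fin// lee_wpmul2l// lee_fin ltW.
rewrite (EFinM (C * (2 * Num.sqrt pi))) (EFinM C) muleA.
by rewrite [leLHS]muleAC.
Qed.

End SplineError.

(** * Comparison of the cubatures *)

Section Sums.
Context {R : realType}.

Lemma normc_sum_le (I : Type) (s : seq I) (F : I -> R[i]) :
  Normc.normc (\sum_(i <- s) F i) <= \sum_(i <- s) Normc.normc (F i).
Proof.
elim: s => [|i s IHs]; first by rewrite !big_nil Normc.normc0.
by rewrite !big_cons (le_trans (le_normcD _ _))// lerD2l.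
Qed.

Lemma normc_real (x : R) : Normc.normc (real_complex R x) = `|x|.
Proof. by rewrite /= expr0n addr0 sqrtr_sqr. Qed.

(** [E] may be infinite; nonnegativity of the coefficients is what makes multiplication distribute
    over the sum. *)
Lemma sum_le_mule (I : eqType) (s : seq I) (x c : I -> R) (E : \bar R) :
  (forall i, i \in s -> 0 <= c i) ->
  (forall i, i \in s -> ((x i)%:E <= (c i)%:E * E)%E) ->
  ((\sum_(i <- s) x i)%:E <= (\sum_(i <- s) c i)%:E * E)%E.
Proof.
elim: s => [|i s IHs] c0 xE; first by rewrite !big_nil mul0e.
rewrite !big_cons !EFinD ge0_muleDl ?lee_fin ?c0 ?mem_head//; last first.
  by rewrite big_seq sumr_ge0// => j js; rewrite c0// inE js orbT.
rewrite leeD ?xE ?mem_head//; apply: IHs => j js.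
  by rewrite c0// inE js orbT.
by rewrite xE// inE js orbT.
Qed.

End Sums.

Unset Implicit Arguments.

(** For a positive multiple [k] of [M] all cosine samples are 1, and the discrete transform at
    radius 0 is [2 sqrt(pi) f(0)] whereas the prescribed datum is 0. The hypothesis [no_aliasing]
    reconciles the two. *)
Theorem theorem3 (R : realType) (Rad C : R) (w : R * R -> R)
    (f : R * R -> R[i]) (N K M N1 : nat) (knot : nat -> R)
    (t lambda : nat -> nat -> nat -> R) (SPL : (nat -> R[i]) -> R -> R[i])
    (Rad_gt0 : 0 < Rad)
    (w_fourier : has_fourier Rad w)
    (w_pseudo_definite : pseudo_definite Rad w)
    (w_norm : (weight_norm Rad w < +oo)%E)
    (N_ge1 : (1 <= N)%N) (M_ge1 : (1 <= M)%N) (M_odd : odd M)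
    (N1_ge5 : (5 <= N1)%N)
    (knot_grid : grid 0 Rad N1 knot)
    (f_smooth : Cinfty_closed_disc Rad f)
    (no_aliasing : (M <= K)%N -> f (0, 0) = 0)
    (quadrature : forall k l : nat, (1 <= l <= a_ k)%N ->
       gauss_quadrature Rad w N k l (t k l) (lambda k l))
    (SPL_spline : forall V : nat -> R[i],
       not_a_knot_splineC N1 knot V (SPL V))
    (C_constant : not_a_knot_constant 0 Rad C) :
  ((Normc.normc (I_spline N M K t lambda knot SPL f - I_poly N M K t lambda f))%:E
   <= (Num.sqrt pi * C * mesh N1 knot ^+ 4)%:E
      * Linfty_closed_disc Rad (radial_derive 4 f)
      * \sum_(0 <= k < K.+1) weight_term Rad w k)%E
  /\
  ((Num.sqrt pi * C * mesh N1 knot ^+ 4)%:E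
      * Linfty_closed_disc Rad (radial_derive 4 f)
      * \sum_(0 <= k < K.+1) weight_term Rad w k
   <= (Num.sqrt pi * C * mesh N1 knot ^+ 4)%:E
      * Linfty_closed_disc Rad (radial_derive 4 f)
      * weight_norm Rad w)%E.
Proof.
have C0 : 0 < C by case: C_constant.
have knot0 : knot 0%N = 0 by case: knot_grid.
set B := Linfty_closed_disc Rad (radial_derive 4 f).
set A := Num.sqrt pi * C * mesh N1 knot ^+ 4.
have A0 : 0 <= A.
  apply: mulr_ge0; last exact: exprn_even_ge0.
  by apply: mulr_ge0; [exact: sqrtr_ge0|exact: ltW].
have B0 : (0 <= B)%E.
  have H : 0 < Rad / 2 < Rad by rewrite divr_gt0//= ltr_pdivrMr// ltr_pMr// ltr1n.
  by apply: le_trans (le_Linfty_closed_disc 0 4 f_smooth H); rewrite lee_fin normc_ge0.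
have wt0 k : (0 <= weight_term Rad w k)%E.
  apply: sume_ge0 => l _; apply: integral_ge0 => r /=; rewrite in_itv/= => /andP[r0 _].
  by rewrite lee_fin mulr_ge0.
split; last first.
  rewrite lee_wpmul2l ?mule_ge0 ?lee_fin//.
  exact: nneseries_lim_ge.
pose e k l j := SPL (spline_data M f knot k l) (Num.sqrt (t k l j))
                - dft M f k l (Num.sqrt (t k l j)).
pose c k l j := `|lambda k l j| * t k l j `^ (- (k%:R / 2)).
(* The factor 2 comes from the bound [2 sqrt pi] on the transform coefficients and cancels against
   the 1/2 in front of the cubatures. *)
pose E := ((2 * A)%:E * B)%E.
have E0 : (0 <= E)%E by rewrite mule_ge0// lee_fin mulr_ge0.
have c0 k l j : 0 <= c k l j by rewrite mulr_ge0// powR_ge0.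
have eE k l j : (k < K.+1)%N -> (1 <= l <= a_ k)%N -> (j < N)%N ->
    ((Normc.normc (e k l j))%:E <= E)%E.
  move=> kK lk jN; have [_ tb _] := quadrature k l lk.
  have /andP[t0 tR] := tb j jN.
  have dataE : spline_data M f knot k l = (fun j => dft M f k l (knot j)).
    apply/funext => m; apply: spline_data_dft => //.
    case: (posnP k) => [->|k0]; first by right; left.
    have [kM|Mk] := ltnP k M; first by left; apply/andP.
    by right; right; apply: no_aliasing; exact: leq_trans Mk _.
  (* Only the interpolated values are rewritten; the spline is still the one attached to
     [spline_data]. *)
  have sp := SPL_spline (spline_data M f knot k l); rewrite {1}dataE in sp.
  have xI : 0 <= Num.sqrt (t k l j) <= Rad.
    rewrite sqrtr_ge0/= -(ger0_norm (ltW Rad_gt0)) -sqrtr_sqr.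
    by rewrite ler_wsqrtr// ltW.
  have := spline_error Rad_gt0 M_ge1 N1_ge5 knot_grid f_smooth C_constant sp xI.
  by rewrite /E /A !mulrA.
have diffE : I_spline N M K t lambda knot SPL f - I_poly N M K t lambda f =
    real_complex R 2^-1 * \sum_(0 <= k < K.+1) \sum_(1 <= l < (a_ k).+1) \sum_(j < N)
      real_complex R (lambda k l j * t k l j `^ (- (k%:R / 2))) * e k l j.
  rewrite /I_spline /I_poly /cubature -mulrBr fmorphV rmorph_nat; congr (_ * _).
  rewrite -sumrB; apply: eq_bigr => k _; rewrite -sumrB; apply: eq_bigr => l _.
  by rewrite -sumrB; apply: eq_bigr => j _; rewrite -mulrBr.
pose T := \sum_(0 <= k < K.+1) \sum_(1 <= l < (a_ k).+1) \sum_(j < N) c k l j.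
have normE : ((\sum_(0 <= k < K.+1) \sum_(1 <= l < (a_ k).+1) \sum_(j < N)
    c k l j * Normc.normc (e k l j))%:E <= T%:E * E)%E.
  apply: sum_le_mule => k kK; first by do 2 apply: sumr_ge0 => ? _.
  apply: sum_le_mule => l lk; first by apply: sumr_ge0.
  apply: sum_le_mule => // j _; rewrite EFinM lee_wpmul2l ?lee_fin//.
  by apply: eE; move: kK lk; rewrite !mem_index_iota.
have normD : Normc.normc (I_spline N M K t lambda knot SPL f - I_poly N M K t lambda f)
    <= 2^-1 * \sum_(0 <= k < K.+1) \sum_(1 <= l < (a_ k).+1) \sum_(j < N)
    c k l j * Normc.normc (e k l j).
  rewrite diffE Normc.normcM normc_real ger0_norm ?invr_ge0// ler_wpM2l ?invr_ge0//.
  apply: le_trans (normc_sum_le _ _) _; apply: ler_sum => k _.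
  apply: le_trans (normc_sum_le _ _) _; apply: ler_sum => l _.
  apply: le_trans (normc_sum_le _ _) _; apply: ler_sum => j _.
  by rewrite Normc.normcM normc_real normrM (ger0_norm (powR_ge0 _ _)).
have TW : (T%:E <= \sum_(0 <= k < K.+1) weight_term Rad w k)%E.
  rewrite /T -sumEFin; apply: lee_sum => k _.
  rewrite -sumEFin /weight_term big_seq [leRHS]big_seq; apply: lee_sum => l.
  rewrite mem_index_iota => lk.
  exact: (gauss_quadrature_sum_le Rad_gt0 N_ge1 lk w_fourier w_pseudo_definite
    w_norm (quadrature k l lk)).
apply: (@le_trans _ _ ((2^-1)%:E * (T%:E * E))%E).
  apply: (@le_trans _ _ (2^-1 * \sum_(0 <= k < K.+1) \sum_(1 <= l < (a_ k).+1)
    \sum_(j < N) c k l j * Normc.normc (e k l j))%:E); first by rewrite lee_fin.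
  by rewrite EFinM lee_wpmul2l// lee_fin invr_ge0.
have -> : ((2^-1)%:E * (T%:E * E) = A%:E * B * T%:E)%E.
  rewrite /E [LHS]muleCA (muleA (2^-1)%:E) -EFinM [LHS]muleC.
  by rewrite mulrA mulVf// mul1r.
by rewrite lee_wpmul2l// mule_ge0.
Qed.
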